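(* Let $s\ge2$ and $G=\mathsf P'_{8\cdot3^s}$. With trivial coefficients, for all $k\ge0$: $H^0(G;\mathbb Z)\cong\mathbb Z$, $H^{4k}(G;\mathbb Z)\cong\mathbb Z/8\cdot3^s\mathbb Z$ for $k>0$, $H^{4k+1}(G;\mathbb Z)=0$, $H^{4k+2}(G;\mathbb Z)\cong\mathbb Z/3^s\mathbb Z$, $H^{4k+3}(G;\mathbb Z)=0$; and $H^j(G;\mathbb Z/3\mathbb Z)\cong\mathbb Z/3\mathbb Z$ for every $j\ge0$.
   Context: $G=\mathsf P'_{8\cdot3^s}=\langle p,q,z\mid p^2=(pq)^2=q^2,\ zpz^{-1}=q,\ zqz^{-1}=pq,\ z^{3^s}=1\rangle$. *)

(* Defs.v *)
(* Group cohomology of a finite group with trivial coefficients,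
   via the standard inhomogeneous (bar) cochain complex. *)
From HB Require Import structures.
From mathcomp Require Import all_boot all_order all_algebra all_fingroup.
Set Implicit Arguments. Unset Strict Implicit. Unset Printing Implicit Defensive.
Import GRing.Theory.
Local Open Scope ring_scope.

(* An n-cochain is a function on sequences of group elements; only its values on
   sequences of length n matter (all predicates below only look at those). *)
Definition cochain (gT : finGroupType) (M : zmodType) := seq gT -> M.

(* i-th face map on a sequence (g_1,...,g_{n+1}) of length n+1:
   i = 0     : (g_2,...,g_{n+1})
   1<=i<=n   : (g_1,...,g_i g_{i+1},...,g_{n+1})
   i = n+1   : (g_1,...,g_n) *)
Definition face (gT : finGroupType) (n i : nat) (s : seq gT) : seq gT :=
  if i == 0%N then behead s
  else if i == n.+1 then take n s
  else take i.-1 s ++ ((nth 1%g s i.-1 * nth 1%g s i)%g :: drop i.+1 s).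

Definition cobound (gT : finGroupType) (M : zmodType) (n : nat)
    (f : cochain gT M) : cochain gT M :=
  fun s => \sum_(i < n.+2) (if odd i then - f (face n i s) else f (face n i s)).

Definition cocycle (gT : finGroupType) (M : zmodType) (n : nat)
    (f : cochain gT M) : Prop :=
  forall s : seq gT, size s = n.+1 -> cobound n f s = 0.

Definition coboundary (gT : finGroupType) (M : zmodType) (n : nat)
    (f : cochain gT M) : Prop :=
  match n with
  | 0%N => forall s : seq gT, size s = 0%N -> f s = 0
  | m.+1 => exists h : cochain gT M,
      forall s : seq gT, size s = m.+1 -> f s = cobound m h s
  end.

(* H^n(gT; M) (trivial action) is isomorphic to the abelian group A:
   there is an additive surjection from the n-cocycles onto A whose kernel is
   exactly the n-coboundaries. *)
Definition cohom_iso (gT : finGroupType) (M A : zmodType) (n : nat) : Prop :=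
  exists phi : cochain gT M -> A,
    [/\ (forall f g, cocycle n f -> cocycle n g ->
           phi (fun s => f s - g s) = phi f - phi g),
        (forall a : A, exists f, cocycle n f /\ phi f = a) &
        (forall f, cocycle n f -> (phi f = 0 <-> coboundary n f))].

Definition cohom_zero (gT : finGroupType) (M : zmodType) (n : nat) : Prop :=
  forall f : cochain gT M, cocycle n f -> coboundary n f.

(* Main.v *)
(* The group is Q_8 : C with C cyclic of order m = 3^s, so it maps onto C with
   kernel of order 8, and onto the binary tetrahedral group Q_8 : C_3.  Two exact
   sequences of G-modules  0 -> M -> U_1 -> U_2 -> ...  are used: the 2-periodic
   one of C, with M-valued functions on C, and a 4-periodic one made of functions
   on the cells of a sphere on which Q_8 acts freely and C_3 by symmetries.
   Stabilisers have order 8, resp. a power of 3, so the U_q are relatively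
   projective only up to the factor c = 8, resp. c = m.  In the double complex of
   homogeneous U_q-valued cochains one direction is therefore exact and the other
   exact up to c, and climbing the staircase compares H^n(G; M) with the cohomology
   of the invariants of the U_q, up to powers of c.  There the differentials are the
   integers 0, m, 0, m, ... for the first sequence and 0, 1, 0, 8, 0, 1, 0, 8, ...
   for the second one.  Since 8 and m are coprime, the two answers determine
   H^n(G; Z) by the Chinese remainder theorem; over Z/3 the first one is enough. *)
Require Import Defs.
From HB Require Import structures.
From mathcomp Require Import all_boot all_order all_algebra all_fingroup.
From mathcomp Require Import cyclic extremal.
From mathcomp Require Import zify ring.

Set Implicit Arguments.
Unset Strict Implicit.
Unset Printing Implicit Defensive.
Import GRing.Theory Num.Theory.

(** * Homogeneous cochains and the staircase *)

Section Homogeneous.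
Local Open Scope ring_scope.
Variable gT : finGroupType.

(** The homogeneous coboundary: an alternating sum over the omissions of one entry, in a form suited
    to induction on the list. On a one-term sequence it is the value at [[::]], so the complex is
    augmented. *)
Fixpoint hdiff (U : zmodType) (F : seq gT -> U) (l : seq gT) : U :=
  if l is g :: t then F t - hdiff (fun t => F (g :: t)) t else 0.

Lemma eq_hdiff (U : zmodType) (F G : seq gT -> U) l :
  (forall t, (size t).+1 = size l -> F t = G t) -> hdiff F l = hdiff G l.
Proof.
elim: l F G => //= g l IH F G eqFG; rewrite eqFG //; congr (_ - _).
by apply: IH => t st; rewrite eqFG //= st.
Qed.

Lemma hdiff_raddf (U V : zmodType) (f : {additive U -> V}) (F : seq gT -> U) l :
  hdiff (fun t => f (F t)) l = f (hdiff F l).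
Proof. by elim: l F => /= [|g l IH] F; rewrite ?raddf0 // raddfB IH. Qed.

Lemma hdiff0 (U : zmodType) l : hdiff (fun _ => 0 : U) l = 0.
Proof. by elim: l => //= g l ->; rewrite subr0. Qed.

Lemma hdiffB (U : zmodType) (F G : seq gT -> U) l :
  hdiff (fun t => F t - G t) l = hdiff F l - hdiff G l.
Proof.
elim: l F G => /= [|g l IH] F G; first by rewrite subr0.
by rewrite IH opprD addrACA -opprD.
Qed.

Lemma hdiffN (U : zmodType) (F : seq gT -> U) l :
  hdiff (fun t => - F t) l = - hdiff F l.
Proof.
by rewrite -[RHS]sub0r -[X in X - _](hdiff0 U l) -hdiffB; apply: eq_hdiff=> t _; rewrite sub0r.
Qed.

Lemma hdiffD (U : zmodType) (F G : seq gT -> U) l :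
  hdiff (fun t => F t + G t) l = hdiff F l + hdiff G l.
Proof.
rewrite -[G in RHS]/(fun t => G t) -[hdiff G l]opprK -hdiffN -hdiffB.
by apply: eq_hdiff => t _; rewrite opprK.
Qed.

Lemma hdiffMn (U : zmodType) (F : seq gT -> U) n l :
  hdiff (fun t => F t *+ n) l = hdiff F l *+ n.
Proof.
elim: n => [|n IH]; first by rewrite mulr0n (hdiff0 U l).
rewrite mulrS -IH -hdiffD.
by apply: eq_hdiff => t _; rewrite mulrS.
Qed.

Lemma hdiff_sum (U : zmodType) (I : Type) (r : seq I) (F : I -> seq gT -> U) l :
  hdiff (fun t => \sum_(i <- r) F i t) l = \sum_(i <- r) hdiff (F i) l.
Proof.
elim: r => [|i r IH].
  by rewrite big_nil -[RHS](hdiff0 U l); apply: eq_hdiff => t _; rewrite big_nil.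
rewrite big_cons -IH -hdiffD.
by apply: eq_hdiff => t _; rewrite big_cons.
Qed.

Lemma hdiff_hdiff (U : zmodType) (F : seq gT -> U) l : hdiff (hdiff F) l = 0.
Proof.
elim: l F => //= g l IH F.
by rewrite hdiffB IH subr0 subrr.
Qed.

Lemma hdiff_map (U : zmodType) (F : seq gT -> U) (f : gT -> gT) l :
  hdiff F (map f l) = hdiff (fun t => F (map f t)) l.
Proof. by elim: l F => //= g l IH F; rewrite IH. Qed.

(* [cr_end] is an additive endomorphism of trace c (Higman's criterion, up to c):
   it makes the rows of the double complex exact up to the factor c. *)
Record coresolution (c : nat) := Coresolution {
  cr_mod :> nat -> zmodType;
  cr_act : forall q, gT -> {additive cr_mod q -> cr_mod q};
  cr_d : forall q, {additive cr_mod q -> cr_mod q.+1};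
  cr_end : forall q, {additive cr_mod q.+1 -> cr_mod q.+1};
  cr_act1 : forall q u, cr_act q 1%g u = u;
  cr_actM : forall q g h u, cr_act q (g * h)%g u = cr_act q g (cr_act q h u);
  cr_d_act : forall q g u, cr_d q (cr_act q g u) = cr_act q.+1 g (cr_d q u);
  cr_dd : forall q u, cr_d q.+1 (cr_d q u) = 0;
  cr_inj : forall u, cr_d 0 u = 0 -> u = 0;
  cr_exact : forall q u, cr_d q.+1 u = 0 -> exists v, cr_d q v == u;
  cr_trace : forall q u,
    \sum_(g : gT) cr_act q.+1 g (cr_end q (cr_act q.+1 g^-1%g u)) = u *+ c }.

(** * Rows, columns and climbing in the double complex *)

Section Staircase.
Variables (c : nat) (U : coresolution c).
Notation act := (@cr_act c U _).
Notation d := (@cr_d c U _).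
Notation e := (@cr_end c U _).

Definition equivariant q (F : seq gT -> U q) :=
  forall g l, F (map (mulg g) l) = act g (F l).

Lemma equivariant_hdiff q (F : seq gT -> U q) :
  equivariant F -> equivariant (hdiff F).
Proof.
move=> eqF g l; rewrite hdiff_map -hdiff_raddf.
by apply: eq_hdiff => t _; apply: eqF.
Qed.

Lemma equivariant_d q (F : seq gT -> U q) :
  equivariant F -> equivariant (fun l => d (F l)).
Proof. by move=> eqF g l; rewrite eqF cr_d_act. Qed.

Lemma equivariantB q (F G : seq gT -> U q) :
  equivariant F -> equivariant G -> equivariant (fun l => F l - G l).
Proof. by move=> eqF eqG g l; rewrite eqF eqG raddfB. Qed.

Lemma equivariantD q (F G : seq gT -> U q) :
  equivariant F -> equivariant G -> equivariant (fun l => F l + G l).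
Proof. by move=> eqF eqG g l; rewrite eqF eqG raddfD. Qed.

Lemma equivariantN q (F : seq gT -> U q) :
  equivariant F -> equivariant (fun l => - F l).
Proof. by move=> eqF g l; rewrite eqF raddfN. Qed.

Lemma equivariantMn q (F : seq gT -> U q) n :
  equivariant F -> equivariant (fun l => F l *+ n).
Proof. by move=> eqF g l; rewrite eqF raddfMn. Qed.

(** Prepending a fixed [g] is a contracting homotopy but is not equivariant; summing over all [g],
    with the conjugates of [e] as weights, makes it so. *)
Definition cone q (F : seq gT -> U q.+1) (l : seq gT) : U q.+1 :=
  \sum_(g : gT) act g (e (act g^-1%g (F (g :: l)))).

Lemma eq_cone q (F G : seq gT -> U q.+1) l :
  (forall g, F (g :: l) = G (g :: l)) -> cone F l = cone G l.
Proof. by move=> eqFG; apply: eq_bigr => g _; rewrite eqFG. Qed.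

Lemma coneB q (F G : seq gT -> U q.+1) l :
  cone (fun t => F t - G t) l = cone F l - cone G l.
Proof.
rewrite /cone -sumrB; apply: eq_bigr => g _.
by rewrite !raddfB.
Qed.

Lemma coneN q (F : seq gT -> U q.+1) l : cone (fun t => - F t) l = - cone F l.
Proof. by rewrite /cone -sumrN; apply: eq_bigr => g _; rewrite !raddfN. Qed.

Lemma coneMn q (F : seq gT -> U q.+1) n l :
  cone (fun t => F t *+ n) l = cone F l *+ n.
Proof. by rewrite /cone -sumrMnl; apply: eq_bigr => g _; rewrite !raddfMn. Qed.

Lemma cone0 q l : cone (fun _ => 0 : U q.+1) l = 0.
Proof. by rewrite /cone big1 // => g _; rewrite !raddf0. Qed.

Lemma equivariant_cone q (F : seq gT -> U q.+1) :
  equivariant F -> equivariant (cone F).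
Proof.
move=> eqF h l; rewrite /cone raddf_sum (reindex_inj (mulgI h)) /=.
apply: eq_bigr => g _.
by rewrite -cr_actM invMg !cr_actM -/(map (mulg h) (g :: l)) eqF -!cr_actM mulgKV.
Qed.

(** Each conjugate of [e] is additive, hence commutes with [hdiff]. Only the omission of the
    prepended [g] survives, and [cr_trace] sums these terms to the factor [c]. *)
Lemma hdiff_cone q (F : seq gT -> U q.+1) l :
  hdiff (cone F) l + cone (hdiff F) l = F l *+ c.
Proof.
rewrite /cone /= hdiff_sum -big_split -cr_trace; apply: eq_bigr => g _ /=.
pose f : {additive U q.+1 -> U q.+1} :=
  (act g : {additive _ -> _}) \o (e \o (act g^-1%g : {additive _ -> _})).
rewrite -[hdiff (fun t => _) l]/(hdiff (fun t => f (F (g :: t))) l) hdiff_raddf.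
by rewrite -[act g _]/(f _) -raddfD addrC subrK.
Qed.

(** Every step consumes one entry, so [climb q F l] reads [F] only on length [q + size l]. *)
Fixpoint climb q (F : seq gT -> U 0) : seq gT -> U q :=
  if q is q'.+1 then cone (fun l => d (climb q' F l)) else F.

Lemma eq_climb q (F G : seq gT -> U 0) l :
  (forall t, size t = (q + size l)%N -> F t = G t) -> climb q F l = climb q G l.
Proof.
elim: q l => /= [|q IH] l eqFG; first exact: eqFG.
by apply: eq_cone => g; rewrite (IH (g :: l)) // => t st; apply: eqFG; rewrite st addSnnS.
Qed.

Lemma climbB q (F G : seq gT -> U 0) l :
  climb q (fun t => F t - G t) l = climb q F l - climb q G l.
Proof.
elim: q l => //= q IH l; rewrite -coneB; apply: eq_cone => g.
by rewrite IH raddfB.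
Qed.

Lemma equivariant_climb q (F : seq gT -> U 0) :
  equivariant F -> equivariant (climb q F).
Proof. by move=> eqF; elim: q => //= q IH; apply/equivariant_cone/equivariant_d. Qed.

(** The other term of [hdiff_cone] vanishes: by the cocycle identity at the first step, later by
    induction and [cr_dd]. *)
Lemma hdiff_climb q (F : seq gT -> U 0) l :
  (forall t, hdiff F t = 0) ->
  hdiff (climb q.+1 F) l = d (climb q F l) *+ c.
Proof.
move=> F0; elim: q l => [|q IH] l;
  rewrite -(hdiff_cone (fun t => d (climb _ F t))) -[LHS]addr0;
  congr (_ + _); rewrite (eq_cone (G := fun=> 0)) ?cone0 // => g.
  by rewrite hdiff_raddf F0 raddf0.
by rewrite hdiff_raddf IH raddfMn cr_dd mul0rn.
Qed.


(** The sign is $(-1)^q$, as each exchange of [hdiff] and [cone] reverses it. *)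
Lemma climb_hdiff q (H : seq gT -> U 0) l :
  exists b : bool, climb q.+1 (hdiff H) l =
    (if b then -%R else id) (d (climb q H l) *+ c - hdiff (climb q.+1 H) l).
Proof.
exists (odd q); elim: q l => [|q IH] l.
  rewrite -(hdiff_cone (fun t => d (H t))) [X in X - _]addrC addrK /=.
  by apply: eq_cone => g; rewrite hdiff_raddf.
rewrite -[LHS]/(cone (fun t => d (climb q.+1 (hdiff H) t)) l).
rewrite (eq_cone (G := fun t => (if ~~ odd q then -%R else id)
    (hdiff (fun t' => d (climb q.+1 H t')) t))); last first.
  move=> g; rewrite IH; move: (g :: l) => t.
  have dX : d (d (climb q H t) *+ c - hdiff (climb q.+1 H) t) =
            - hdiff (fun t' => d (climb q.+1 H t')) t.
    by rewrite raddfB raddfMn cr_dd mul0rn sub0r hdiff_raddf.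
  by case: (odd q); rewrite [LHS]raddfN || idtac; rewrite dX ?opprK.
rewrite -(hdiff_cone (fun t => d (climb q.+1 H t))) [X in X - _]addrC addrK.
by rewrite [odd q.+1]/=; case: (odd q) => //; apply: coneN.
Qed.

(** The boolean equality in [cr_exact] lets [xchoose] pick a preimage; 0 is a default off the
    kernel. *)
Definition preim_d q (u : U q.+1) : U q :=
  match d u =P 0 with ReflectT du0 => xchoose (cr_exact du0) | _ => 0 end.

Lemma d_preim_d q (u : U q.+1) : d u = 0 -> d (preim_d u) = u.
Proof.
by rewrite /preim_d; case: eqP => // du0 _; apply/eqP/(xchooseP (cr_exact du0)).
Qed.

(** A nonempty sequence is a unique translate of one starting with 1; preimages are chosen on the
    latter and transported by the action. *)
Lemma column_exact p q (F : seq gT -> U q.+1) :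
    equivariant F -> (forall l, size l = p.+1 -> d (F l) = 0) ->
  exists2 E : seq gT -> U q,
    equivariant E & forall l, size l = p.+1 -> d (E l) = F l.
Proof.
move=> eqF dF0.
exists (fun l => if l is g :: _ then act g (preim_d (F (map (mulg g^-1%g) l))) else 0).
  move=> h [|g t] /=; first by rewrite raddf0.
  rewrite cr_actM -map_comp; congr (act h (act g (preim_d (F (_ :: _))))).
    by rewrite invMg mulgA mulgKV.
  by apply: eq_map => x /=; rewrite invMg mulgA mulgKV.
move=> [|g t] // sl; rewrite cr_d_act d_preim_d; last by rewrite dF0 ?size_map.
by rewrite -eqF -map_comp map_id_in // => x _ /=; rewrite mulKVg.
Qed.

Definition is_fixed q (u : U q) := forall g, act g u = u.

Lemma equivariant_nil q (F : seq gT -> U q) : equivariant F -> is_fixed (F [::]).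
Proof. by move=> eqF g; rewrite -eqF. Qed.

Lemma equivariant_cst q (u : U q) : is_fixed u -> equivariant (fun=> u).
Proof. by move=> iu g l. Qed.

(** * The end of the staircase: kernel and image up to powers of [c] *)

Section Degree.
Variable n : nat.

(* On a cocycle of degree n+1, a sequence of length n+2 is used up by n+2 steps;
   the value at the empty sequence is an invariant of U_{n+2}. *)
Definition edge (F : seq gT -> U 0) : U n.+2 := climb n.+2 F [::].

Lemma is_fixed_edge F : equivariant F -> is_fixed (edge F).
Proof. by move=> eqF; apply/equivariant_nil/equivariant_climb. Qed.

Lemma edge_hdiff (H : seq gT -> U 0) : equivariant H ->
  exists2 u : U n.+1, is_fixed u & edge (hdiff H) = d u *+ c.
Proof.
move=> eqH; have [b] := climb_hdiff n.+1 H [::].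
have iu := equivariant_nil (@equivariant_climb n.+1 _ eqH).
rewrite -/(edge _) [hdiff _ _]/= subr0 => ->; case: b; last by exists (climb n.+1 H [::]).
by exists (- climb n.+1 H [::]); [move=> g; rewrite raddfN iu | rewrite raddfN mulNrn].
Qed.

Lemma d_edge (F : seq gT -> U 0) :
  (forall l, hdiff F l = 0) -> d (edge F) *+ c = 0.
Proof. by move=> F0; rewrite -hdiff_climb. Qed.

Lemma edge_coboundary (F : seq gT -> U 0) (u : U n.+1) :
    equivariant F -> (forall l, hdiff F l = 0) ->
    is_fixed u -> edge F = d u ->
  exists k, exists2 H : seq gT -> U 0,
    equivariant H & forall l, size l = n.+2 -> F l *+ (c ^ k) = hdiff H l.
Proof.
move=> eqF F0 iu Fu.
(* Applying [hdiff] kills [B] and turns [climb q.+1 F] into [c] times [d (climb q F)]: the relation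
   moves one stair down. *)
have hdiff_rel q k A (B : seq gT -> U q.+1) r :
    (forall l, size l = r ->
       climb q.+1 F l *+ (c ^ k) = d (A l : U q) + hdiff B l) ->
  forall l, size l = r.+1 -> d (climb q F l *+ (c ^ k.+1) - hdiff A l) = 0.
  move=> AB l sl; rewrite raddfB raddfMn expnS mulrnA -hdiff_climb // -hdiffMn.
  rewrite -hdiff_raddf -hdiffB (eq_hdiff (G := hdiff B)) ?hdiff_hdiff // => t st.
  by rewrite AB; [rewrite [X in X - _]addrC addrK | apply: succn_inj; rewrite st].
have descend r q : (q + r = n.+1)%N -> exists k (A : seq gT -> U q) B,
    [/\ equivariant A, equivariant B & forall l, size l = r ->
      climb q.+1 F l *+ (c ^ k) = d (A l) + hdiff B l].
  elim: r q => [|r IH] q.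
    rewrite addn0 => def_q; rewrite {}def_q.
    exists 0%N, (fun=> u), (fun=> 0); split; first exact: equivariant_cst.
      by move=> g l; rewrite raddf0.
    by case=> // _; rewrite mulr1n addr0 -/(edge F).
  rewrite -addSnnS => /IH[k [A [B [eqA _ AB]]]].
  have dE := hdiff_rel _ _ _ _ _ AB.
  have [|A' eqA' dA'] := column_exact (p := r) _ dE.
    by apply: equivariantB; [apply/equivariantMn/equivariant_climb | apply: equivariant_hdiff].
  exists k.+1, A', A; split=> // l sl.
  by rewrite dA' // subrK.
have [k [A [B [eqA _ AB]]]] := descend n.+1 0%N (add0n _).
(* At the bottom [d] is injective, so the difference itself is zero. *)
exists k.+1, A => // l sl; apply/eqP; rewrite -subr_eq0; apply/eqP/cr_inj.
exact: hdiff_rel AB l sl.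
Qed.

(** From the constant [y], cochains [Y] with [d Y = hdiff Y'] are chosen down to position 0, where
    [Y] is the cocycle. Climbing back gains a factor [c] at each of the [n.+2] steps, up to images
    of [d] and [hdiff]. *)
Lemma edge_surj (y : U n.+2) : is_fixed y -> d y = 0 ->
  exists F : seq gT -> U 0, [/\ equivariant F,
    forall l, size l = n.+3 -> hdiff F l = 0 &
    exists2 u : U n.+1, is_fixed u & edge F = y *+ (c ^ n.+2) + d u].
Proof.
move=> iy dy.
have ascend q r (Y : seq gT -> U q) (Y' : seq gT -> U q.+1) (B : seq gT -> U q) F :
    equivariant Y' -> equivariant B ->
    (forall l, size l = r.+1 -> d (Y l) = hdiff Y' l) ->
    (forall l, size l = r.+1 ->
       d (climb q F l) = d (Y l) *+ (c ^ q) + hdiff (fun t => d (B t)) l) ->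
  exists2 B' : seq gT -> U q.+1, equivariant B' & forall l, size l = r ->
    climb q.+1 F l = Y' l *+ (c ^ q.+1) + d (B l) *+ c + hdiff B' l.
  move=> eqY' eqB dY climbF.
  exists (fun l => - (cone Y' l *+ (c ^ q) + cone (fun t => d (B t)) l)).
    apply/equivariantN/equivariantD/equivariant_cone/equivariant_d => //.
    exact/equivariantMn/equivariant_cone.
  move=> l sl; rewrite hdiffN hdiffD hdiffMn.
  rewrite expnS mulrnA -!hdiff_cone -(hdiff_cone (fun t => d (B t))).
  rewrite /= (eq_cone (G := fun t => hdiff Y' t *+ (c ^ q) - - hdiff (fun t => d (B t)) t)).
    by rewrite coneB coneMn coneN opprK mulrnDl addrACA [X in X - _]addrC addrK.
  by move=> g; rewrite opprK climbF ?dY //= sl.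
(* The cocycle is known only at the bottom, so the descent carries an implication valid for every
   [F], to be used on the way up. *)
have descend r q : (q + r = n.+1)%N -> exists Y : seq gT -> U q,
    [/\ equivariant Y, forall l, size l = r.+2 -> d (hdiff Y l) = 0 &
       forall F : seq gT -> U 0,
         (exists2 B : seq gT -> U q, equivariant B & forall l, size l = r.+1 ->
          d (climb q F l) = d (Y l) *+ (c ^ q) + hdiff (fun t => d (B t)) l) ->
       exists2 u : U n.+1, is_fixed u & edge F = y *+ (c ^ n.+2) + d u].
  elim: r q => [|r IH] q.
    rewrite addn0 => def_q; rewrite {}def_q.
    have [||Y eqY dY] := column_exact (p := 0) (F := hdiff (fun=> y)).
    - exact/equivariant_hdiff/equivariant_cst.
    - by move=> l _; rewrite -hdiff_raddf dy hdiff0.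
    exists Y; split=> // [l sl|F [B eqB climbF]].
      rewrite -hdiff_raddf (eq_hdiff (G := hdiff (fun=> y))) ?hdiff_hdiff // => t st.
      by rewrite dY //; apply: succn_inj; rewrite st.
    have [B' _ def_edge] := ascend _ 0 _ _ _ _ (equivariant_cst iy) eqB dY climbF.
    exists (B [::] *+ c); first by move=> g; rewrite raddfMn -eqB.
    by rewrite [edge F]def_edge // addr0 raddfMn.
  rewrite -addSnnS => /IH[Y' [eqY' dhY' asc]].
  have [||Y eqY dY] := column_exact (p := r.+1) (F := hdiff Y').
  - exact/equivariant_hdiff.
  - exact: dhY'.
  exists Y; split=> // [l sl|F [B eqB climbF]].
    rewrite -hdiff_raddf (eq_hdiff (G := hdiff Y')) ?hdiff_hdiff // => t st.
    by rewrite dY //; apply: succn_inj; rewrite st.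
  have [B' eqB' climbF'] := ascend _ _ _ _ _ _ eqY' eqB dY climbF.
  apply: asc; exists B' => // l sl.
  by rewrite climbF' // !raddfD !raddfMn cr_dd mul0rn addr0 hdiff_raddf.
have [Y [eqY dhY asc]] := descend n.+1 0%N (add0n _).
exists Y; split=> // [l sl|]; first exact/cr_inj/dhY.
apply: asc; exists (fun=> 0) => [g l|l sl]; first by rewrite raddf0.
by rewrite hdiff_raddf hdiff0 raddf0 addr0 mulr1n.
Qed.

End Degree.
End Staircase.
End Homogeneous.

(** * Inhomogeneous cochains; cellular coresolutions *)

Section Inhomogeneous.
Local Open Scope ring_scope.
Variable gT : finGroupType.

Lemma hdiffE (U : zmodType) (F : seq gT -> U) l :
  hdiff F l = \sum_(i < size l)
    (if odd i then - F (take i l ++ drop i.+1 l) else F (take i l ++ drop i.+1 l)).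
Proof.
elim: l F => [|g l IH] F /=; first by rewrite big_ord0.
rewrite IH big_ord_recl /= drop0 -sumrN; congr (_ + _).
by apply: eq_bigr => i _ /=; case: odd => //=; rewrite opprK.
Qed.

Definition steps (l : seq gT) : seq gT :=
  if l is g :: t then pairmap (fun x y => x^-1 * y)%g g t else [::].

Lemma size_steps l : size (steps l) = (size l).-1.
Proof. by case: l => //= g t; rewrite size_pairmap. Qed.

Lemma steps_scanl g s : steps (g :: scanl mulg g s) = s.
Proof. exact: (scanlK (f := fun x y => (x^-1 * y)%g) (g := mulg) (@mulKg gT)). Qed.

Lemma scanl_mulg (g : gT) s : scanl mulg g s = map (mulg g) (scanl mulg 1%g s).
Proof.
suff IH h : scanl mulg (g * h)%g s = map (mulg g) (scanl mulg h s).
  by rewrite -IH mulg1.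
by elim: s h => //= x s IH h; rewrite -IH mulgA.
Qed.

Lemma steps_map g l : steps (map (mulg g) l) = steps l.
Proof.
case: l => //= h t; elim: t h => //= k t IH h.
by rewrite IH invMg -mulgA mulKg.
Qed.

Lemma steps_inv g t :
  g :: t = map (mulg g) (1%g :: scanl mulg 1%g (steps (g :: t))).
Proof.
rewrite /= mulg1 -scanl_mulg.
by rewrite (pairmapK (f := fun x y => (x^-1 * y)%g) (g := mulg) (@mulKVg gT)).
Qed.

(** Omitting an interior entry multiplies the two quotients around it, where that entry cancels;
    omitting an end drops a quotient. *)
Lemma steps_face n i l : size l = n.+2 -> (i < n.+2)%N ->
  steps (take i l ++ drop i.+1 l) = face n i (steps l).
Proof.
move=> sl lt_i; rewrite /face; case: eqP => [->|/eqP i_gt0].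
  by case: l sl => [|g [|h t]] //= _; rewrite drop0.
case: eqP => [->|/eqP i_neq].
  rewrite drop_oversize ?cats0 ?sl //; case: l sl => [|g t] //= [st].
  elim: n t g st {lt_i i_gt0} => [|n IH] [|h t] g //= [st].
  by rewrite IH.
have lt_i' : (i < n.+1)%N by rewrite ltn_neqAle i_neq -ltnS.
have lt_il : (i.+1 < size l)%N by rewrite sl ltnS.
(* Here [x] is the entry to omit, with a predecessor in [g :: a] and the successor [y]. *)
have [g [a [x [y [b [-> def_i]]]]]] :
    exists g a x y b, l = (g :: a) ++ x :: y :: b /\ i = (size a).+1.
  case: i i_gt0 lt_il {lt_i i_neq lt_i'} => // i _; case: l {sl} => // g t.
  rewrite !ltnS => lt_it; have lt_i := ltnW lt_it.
  exists g, (take i t), (nth 1%g t i), (nth 1%g t i.+1), (drop i.+2 t).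
  by rewrite -!drop_nth // cat_cons cat_take_drop size_takel // ltnW.
have drop_catk (u v : seq gT) k : drop (size u + k) (u ++ v) = drop k v.
  by rewrite addnC -drop_drop drop_size_cat.
have nth_catk (u v : seq gT) k : nth 1%g (u ++ v) (size u + k) = nth 1%g v k.
  by rewrite nth_cat ltnNge leq_addr addKn.
rewrite def_i /= take_size_cat // -addn1 drop_catk /= !pairmap_cat /=.
rewrite -(size_pairmap (fun x y => x^-1 * y)%g g a) take_size_cat // -!addnS.
by rewrite drop_catk nth_catk nth_cat ltnn subnn /= ?drop0 mulgA mulgK.
Qed.

(** The value 0 on other lengths makes the cocycle identity hold on all sequences, as the staircase
    requires. *)
Definition homog (M : zmodType) n (f : cochain gT M) (l : seq gT) : M :=
  if size l == n.+1 then f (steps l) else 0.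

Lemma homog_map (M : zmodType) n (f : cochain gT M) g l :
  homog n f (map (mulg g) l) = homog n f l.
Proof. by rewrite /homog size_map steps_map. Qed.

Lemma hdiff_homog (M : zmodType) n (f : cochain gT M) l :
  hdiff (homog n f) l = if size l == n.+2 then cobound n f (steps l) else 0.
Proof.
case: eqP => [sl|sl].
  rewrite hdiffE /cobound sl; apply: eq_bigr => i _.
  have -> : homog n f (take i l ++ drop i.+1 l) = f (face n i (steps l)).
    rewrite /homog size_cat size_take size_drop sl ltn_ord subSS.
    by rewrite subnKC; [rewrite eqxx (steps_face sl) ?ltn_ord | rewrite -ltnS].
  by [].
rewrite (eq_hdiff (G := fun=> 0)) ?hdiff0 // => t st; rewrite /homog.
by case: eqP => // st'; case: sl; rewrite -st st'.
Qed.

Lemma cocycle_homog (M : zmodType) n (f : cochain gT M) :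
  cocycle n f -> forall l, hdiff (homog n f) l = 0.
Proof.
by move=> fZ l; rewrite hdiff_homog; case: eqP => // sl; rewrite fZ ?size_steps ?sl.
Qed.

Definition dehomog (M : zmodType) (F : seq gT -> M) : cochain gT M :=
  fun s => F (1%g :: scanl mulg 1%g s).

Lemma dehomogK (M : zmodType) n (F : seq gT -> M) l :
    (forall g l', F (map (mulg g) l') = F l') -> size l = n.+1 ->
  homog n (dehomog F) l = F l.
Proof.
move=> invF sl; rewrite /homog sl eqxx.
by case: l sl => // g t _; rewrite [in RHS]steps_inv invF.
Qed.

Lemma cobound_dehomog (M : zmodType) n (F : seq gT -> M) s :
    (forall g l, F (map (mulg g) l) = F l) -> size s = n.+1 ->
  cobound n (dehomog F) s = hdiff F (1%g :: scanl mulg 1%g s).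
Proof.
move=> invF ss; have sl : size (1%g :: scanl mulg 1%g s) = n.+2 by rewrite /= size_scanl ss.
rewrite -[in LHS](steps_scanl 1%g s).
transitivity (hdiff (homog n (dehomog F)) (1%g :: scanl mulg 1%g s)).
  by rewrite hdiff_homog sl eqxx.
by apply: eq_hdiff => t; rewrite sl => -[st]; apply: dehomogK.
Qed.

Lemma homog_scanl (M : zmodType) n (f : cochain gT M) s : size s = n ->
  homog n f (1%g :: scanl mulg 1%g s) = f s.
Proof. by move=> ss; rewrite /homog steps_scanl [size _]/= size_scanl ss eqxx. Qed.

End Inhomogeneous.

(** * Coresolutions from cells with a transitive action *)

Section Cellular.
Local Open Scope ring_scope.
Variables (gT : finGroupType) (M : zmodType).

(* [cell_d q] acts on constant functions as multiplication by [cell_mult q]; the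
   actions on cells are transitive, so that constants are the only invariants. *)
Record cell_complex (c : nat) := CellComplex {
  cells : nat -> finType;
  cell_act : forall q, gT -> cells q -> cells q;
  cell_d : forall q, {additive {ffun cells q -> M} -> {ffun cells q.+1 -> M}};
  cell_mult : nat -> nat;
  cell_weight : forall q, cells q -> nat;
  cell_pt : forall q, cells q;
  cell_act1 : forall q (x : cells q), cell_act 1%g x = x;
  cell_actM : forall q g h (x : cells q), cell_act (g * h)%g x = cell_act g (cell_act h x);
  cell_trans : forall q (x y : cells q), exists g, cell_act g x = y;
  cell_d_act : forall q g (F : {ffun cells q -> M}), cell_d q [ffun x => F (cell_act g x)] =
    [ffun x => cell_d q F (cell_act g x)];
  cell_d_const : forall q (m : M), cell_d q [ffun=> m] = [ffun=> m *+ cell_mult q];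
  cell_mult0 : cell_mult 0 = 0%N;
  cell_dd : forall q F, cell_d q.+1 (cell_d q F) = 0;
  cell_exact0 : forall F, cell_d 0 F = 0 -> exists m, F = [ffun=> m];
  cell_exact : forall q F, cell_d q.+1 F = 0 -> exists E, cell_d q E = F;
  cell_weight_sum : forall q (x : cells q), (\sum_g cell_weight (cell_act g x))%N = c }.

Section Pullback.
Variables (X : finType) (a : gT -> X -> X) (g : gT).

Definition pullback (F : {ffun X -> M}) : {ffun X -> M} := [ffun x => F (a g^-1%g x)].

Fact pullback_additive : zmod_morphism pullback.
Proof. by move=> F G; apply/ffunP=> x; rewrite !ffunE. Qed.
HB.instance Definition _ := GRing.isZmodMorphism.Build _ _ pullback pullback_additive.
End Pullback.

Section Weigh.
Variables (X : finType) (w : X -> nat).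

Definition weigh (F : {ffun X -> M}) : {ffun X -> M} := [ffun x => F x *+ w x].

Fact weigh_additive : zmod_morphism weigh.
Proof. by move=> F G; apply/ffunP=> x; rewrite !ffunE mulrnBl. Qed.
HB.instance Definition _ := GRing.isZmodMorphism.Build _ _ weigh weigh_additive.
End Weigh.

Section Const.
Variable X : finType.

Definition constf (m : M) : {ffun X -> M} := [ffun=> m].

Fact constf_additive : zmod_morphism constf.
Proof. by move=> F G; apply/ffunP=> x; rewrite !ffunE. Qed.
HB.instance Definition _ := GRing.isZmodMorphism.Build _ _ constf constf_additive.
End Const.

Section CellCoresolution.
Variables (c : nat) (K : cell_complex c).

(** The coefficients occupy position 0, so functions on [q]-cells sit in position [q.+1]. *)
Definition cc_mod (q : nat) : zmodType :=
  if q is q'.+1 then {ffun cells K q' -> M} else M.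

Definition cc_act (q : nat) (g : gT) : {additive cc_mod q -> cc_mod q} :=
  if q is q'.+1 return {additive cc_mod q -> cc_mod q}
  then pullback (@cell_act c K q') g else idfun.

Definition cc_d (q : nat) : {additive cc_mod q -> cc_mod q.+1} :=
  if q is q'.+1 return {additive cc_mod q -> cc_mod q.+1}
  then cell_d K q' else @constf (cells K 0).

Definition cc_end (q : nat) : {additive cc_mod q.+1 -> cc_mod q.+1} :=
  weigh (@cell_weight c K q).

Lemma cc_act1 q u : cc_act q 1%g u = u.
Proof. by case: q u => //= q u; apply/ffunP => x; rewrite ffunE invg1 cell_act1. Qed.

Lemma cc_actM q g h u : cc_act q (g * h)%g u = cc_act q g (cc_act q h u).
Proof.
by case: q u => //= q u; apply/ffunP => x; rewrite !ffunE invMg cell_actM.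
Qed.

Lemma cc_d_act q g u : cc_d q (cc_act q g u) = cc_act q.+1 g (cc_d q u).
Proof.
case: q u => [|q] /= u; first by apply/ffunP => x; rewrite !ffunE.
exact: cell_d_act.
Qed.

Lemma cc_dd q u : cc_d q.+1 (cc_d q u) = 0.
Proof.
case: q u => [|q] /= u; last exact: cell_dd.
by rewrite /constf cell_d_const cell_mult0; apply/ffunP => x; rewrite !ffunE.
Qed.

Lemma cc_inj u : cc_d 0 u = 0 -> u = 0.
Proof. by move=> /ffunP/(_ (cell_pt K 0)); rewrite !ffunE. Qed.

Lemma cc_exact q u : cc_d q.+1 u = 0 -> exists v, cc_d q v == u.
Proof.
case: q u => [|q] /= u du0.
  by have [m ->] := cell_exact0 du0; exists m.
by have [v <-] := cell_exact du0; exists v.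
Qed.

(** Conjugation translates the weight, so the trace multiplies the value at [x] by the sum of the
    weights of all [cell_act g x]. *)
Lemma cc_trace q u :
  \sum_(g : gT) cc_act q.+1 g (cc_end q (cc_act q.+1 g^-1%g u)) = u *+ c.
Proof.
apply/ffunP => x; rewrite sum_ffunE ffunMnE /=.
transitivity (u x *+ \sum_g cell_weight (cell_act g x))%N; last first.
  by rewrite cell_weight_sum.
rewrite (reindex_inj invg_inj) /= -sumrMnr; apply: eq_bigr => g _.
by rewrite !ffunE !invgK -cell_actM mulVg cell_act1.
Qed.

Definition cell_coresolution : coresolution gT c :=
  Coresolution cc_act1 cc_actM cc_d_act cc_dd cc_inj cc_exact cc_trace.

Lemma is_fixed_const q (u : {ffun cells K q -> M}) :
  @is_fixed _ _ cell_coresolution q.+1 u -> u = [ffun=> u (cell_pt K q)].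
Proof.
move=> iu; apply/ffunP => x; rewrite ffunE.
have [g <-] := cell_trans (cell_pt K q) x.
by rewrite -[in LHS](iu g) /= ffunE -cell_actM mulVg cell_act1.
Qed.

Lemma const_is_fixed q (m : M) :
  @is_fixed _ _ cell_coresolution q.+1 ([ffun=> m] : {ffun cells K q -> M}).
Proof. by move=> g; apply/ffunP => x; rewrite !ffunE. Qed.

Lemma cr_d_const q (m : M) :
  cr_d cell_coresolution q.+1 ([ffun=> m] : {ffun cells K q -> M}) =
  [ffun=> m *+ cell_mult K q].
Proof. exact: cell_d_const. Qed.

Let equivariant_homog n (f : cochain gT M) :
  equivariant (homog n f : seq gT -> cell_coresolution 0).
Proof. by move=> g l; rewrite homog_map. Qed.

(** The edge is invariant, hence a constant function; this is its value. Index [n] belongs to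
    cochains of degree [n.+1]. *)
Definition edge_map n (f : cochain gT M) : M :=
  (edge n (homog n.+1 f : seq gT -> cell_coresolution 0) : {ffun _ -> M})
    (cell_pt K n.+1).

Lemma edge_mapE n f :
  edge n (homog n.+1 f : seq gT -> cell_coresolution 0) = [ffun=> edge_map n f].
Proof. exact/is_fixed_const/is_fixed_edge/equivariant_homog. Qed.

Lemma edge_mapB n f g :
  edge_map n (fun s => f s - g s) = edge_map n f - edge_map n g.
Proof.
have edgeB : edge n (homog n.+1 (fun s => f s - g s) : seq gT -> cell_coresolution 0) =
    edge n (homog n.+1 f : seq gT -> cell_coresolution 0)
    - edge n (homog n.+1 g : seq gT -> cell_coresolution 0).
  rewrite -climbB; apply: eq_climb => t _.
  by rewrite /homog; case: ifP => // _; rewrite subr0.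
by rewrite /edge_map edgeB !ffunE.
Qed.

Lemma eq_edge_map n (f g : cochain gT M) :
  (forall s, f s = g s) -> edge_map n f = edge_map n g.
Proof.
move=> eqfg; rewrite /edge_map.
rewrite [edge _ _](_ : _ = edge n (homog n.+1 g : seq gT -> cell_coresolution 0)) //.
by apply: eq_climb => t _; rewrite /homog eqfg.
Qed.

Lemma edge_mapMn n (f : cochain gT M) k :
  edge_map n (fun s => f s *+ k) = edge_map n f *+ k.
Proof.
elim: k => [|k IH].
  rewrite (@eq_edge_map n _ (fun s => f s - f s)) ?edge_mapB ?subrr // => t.
  by rewrite subrr.
rewrite (@eq_edge_map n _ (fun s => f s - ((f s - f s) - f s *+ k))) => [|t].
  by rewrite !edge_mapB IH subrr sub0r opprK mulrS.
by rewrite subrr sub0r opprK mulrS.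
Qed.

Lemma edge_map_coboundary n f : coboundary n.+1 f ->
  exists m, edge_map n f = m *+ cell_mult K n.
Proof.
move=> [h fh].
have [u iu] := edge_hdiff n (equivariant_homog n h).
rewrite {iu}(is_fixed_const iu) cr_d_const => def_edge.
exists ((u : {ffun cells K n -> M}) (cell_pt K n) *+ c); rewrite /edge_map.
rewrite [edge _ _](_ : _ = edge n (hdiff (homog n h) : seq gT -> cell_coresolution 0)).
  by rewrite def_edge ffunMnE ffunE mulrnAC.
(* The edge reads only length [n.+2], where [f] is the given coboundary. *)
apply: eq_climb => t st; rewrite hdiff_homog /homog st addn0 eqxx.
by rewrite fh // size_steps st addn0.
Qed.

Lemma edge_map_cocycle n f : cocycle n.+1 f ->
  edge_map n f *+ cell_mult K n.+1 *+ c = 0.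
Proof.
move=> fZ; have /= := @d_edge _ _ cell_coresolution n _ (cocycle_homog fZ).
rewrite edge_mapE cr_d_const => /ffunP/(_ (cell_pt K n.+2)).
by rewrite ffunMnE !ffunE.
Qed.

Lemma coboundary_edge_map n f m :
    cocycle n.+1 f -> edge_map n f = m *+ cell_mult K n ->
  exists k, coboundary n.+1 (fun s => f s *+ (c ^ k)).
Proof.
move=> fZ fm.
have [||k [H eqH FH]] := @edge_coboundary _ _ cell_coresolution n (homog n.+1 f)
  ([ffun=> m] : {ffun cells K n -> M}) (equivariant_homog n.+1 f) (cocycle_homog fZ).
- exact: const_is_fixed.
- by rewrite edge_mapE fm; rewrite cr_d_const.
exists k, (dehomog H) => s ss; rewrite cobound_dehomog // -FH ?homog_scanl //.
by rewrite /= size_scanl ss.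
Qed.

Lemma edge_map_surj n m : m *+ cell_mult K n.+1 = 0 ->
  exists2 f, cocycle n.+1 f &
  exists m', edge_map n f = m *+ (c ^ n.+2) + m' *+ cell_mult K n.
Proof.
move=> m0.
have [||F [eqF F0 [u iu def_edge]]] := @edge_surj _ _ cell_coresolution n
  ([ffun=> m] : {ffun cells K n.+1 -> M}).
- exact: const_is_fixed.
- by rewrite cr_d_const m0; apply/ffunP => x; rewrite !ffunE.
have invF g l : F (map (mulg g) l) = F l by rewrite eqF.
exists (dehomog F) => [s ss|].
  by rewrite cobound_dehomog // F0 //= size_scanl ss.
exists ((u : {ffun cells K n -> M}) (cell_pt K n)); rewrite /edge_map.
rewrite [edge _ _](_ : _ = edge n F).
  by rewrite def_edge (is_fixed_const iu) cr_d_const !ffunE ffunMnE !ffunE.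
by apply: eq_climb => t st; rewrite dehomogK // st addn0.
Qed.

End CellCoresolution.
End Cellular.

(** * The periodic complex of a cyclic group *)

Section CyclicComplex.
Local Open Scope ring_scope.
Variables (gT : finGroupType) (M : zmodType) (p c : nat) (pi : gT -> 'I_p.+2).
Hypothesis piM : forall g h, pi (g * h)%g = pi g + pi h.
Hypothesis card_pi : forall x, #|[set g | pi g == x]| = c.
Hypothesis c_gt0 : (0 < c)%N.

Definition shift_diff (F : {ffun 'I_p.+2 -> M}) : {ffun 'I_p.+2 -> M} :=
  [ffun x => F (x + 1) - F x].

Fact shift_diff_additive : zmod_morphism shift_diff.
Proof.
by move=> F G; apply/ffunP=> x; rewrite !ffunE opprD addrACA -opprD.
Qed.
HB.instance Definition _ := GRing.isZmodMorphism.Build _ _ shift_diff shift_diff_additive.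

Definition total (X Y : finType) (F : {ffun X -> M}) : {ffun Y -> M} :=
  [ffun=> \sum_x F x].

Fact total_additive X Y : zmod_morphism (@total X Y).
Proof.
move=> F G; apply/ffunP=> y; rewrite !ffunE -sumrB.
by apply: eq_bigr => x _; rewrite !ffunE.
Qed.
HB.instance Definition _ X Y :=
  GRing.isZmodMorphism.Build _ _ (@total X Y) (@total_additive X Y).

Let endo := {additive {ffun 'I_p.+2 -> M} -> {ffun 'I_p.+2 -> M}}.

(** Dual of the usual periodic resolution: alternately a generator minus 1 and the norm. *)
Definition cyclic_d (q : nat) : endo :=
  if odd q then @total 'I_p.+2 'I_p.+2 : endo else shift_diff : endo.

Lemma pi1 : pi 1%g = 0.
Proof. by apply: (addrI (pi 1%g)); rewrite -piM mulg1 addr0. Qed.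

Lemma shift_invariant (F : {ffun 'I_p.+2 -> M}) :
  shift_diff F = 0 -> F = [ffun=> F 0].
Proof.
move=> /ffunP dF; apply/ffunP => x; rewrite ffunE.
rewrite -[x]natr_Zp; elim: (x : nat) => [|k IH] //.
rewrite -IH -natr1; apply/eqP; rewrite -subr_eq0; apply/eqP.
by have := dF k%:R; rewrite !ffunE.
Qed.

(** Partial sums form a discrete primitive; the vanishing total lets it close up around the
    cycle. *)
Lemma shift_exact (F : {ffun 'I_p.+2 -> M}) :
  \sum_x F x = 0 -> exists E, shift_diff E = F.
Proof.
move=> F0; exists [ffun x : 'I_p.+2 => \sum_(y : 'I_p.+2 | (y < x)%N) F y].
apply/ffunP => x; rewrite !ffunE; have lt_xp : (x < p.+2)%N := ltn_ord x.
have [lt_x|ge_x] := ltnP x.+1 p.+2.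
  have valS : nat_of_ord (x + 1) = x.+1 by rewrite /= modn_small addn1.
  rewrite (bigD1 x) /=; last by rewrite -[X in (_ < X)%N]/(nat_of_ord (x + 1)) valS.
  rewrite (eq_bigl (fun y : 'I_p.+2 => (y < x)%N)) ?addrK // => y.
  rewrite -[X in (_ < X)%N]/(nat_of_ord (x + 1)) valS ltnS ltn_neqAle andbC.
  by rewrite -(inj_eq val_inj).
(* At the last index, [x + 1] wraps around to 0. *)
have val0 : nat_of_ord (x + 1) = 0%N.
  by rewrite /= addn1 (_ : x.+1 = p.+2) ?modnn //; apply/eqP; rewrite eqn_leq lt_xp.
rewrite big_pred0; last by move=> y; rewrite -[X in (_ < X)%N]/(nat_of_ord (x + 1)) val0.
apply/esym/eqP; rewrite sub0r -addr_eq0; apply/eqP; rewrite -[RHS]F0 [RHS](bigD1 x) //=.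
congr (F x + _); apply: eq_bigl => y; rewrite ltn_neqAle -(inj_eq val_inj) /=.
by rewrite -ltnS (leq_trans (ltn_ord y)) ?andbT.
Qed.

Lemma cyclic_d_act q g (F : {ffun 'I_p.+2 -> M}) : cyclic_d q [ffun x => F (pi g + x)] =
  [ffun x => cyclic_d q F (pi g + x)].
Proof.
rewrite /cyclic_d; case: odd; apply/ffunP => x; rewrite !ffunE ?addrA //.
rewrite [RHS](reindex_inj (addrI (pi g))) /=.
by apply: eq_bigr => y _; rewrite ffunE.
Qed.

Lemma cyclic_d_const q (m : M) :
  cyclic_d q [ffun=> m] = [ffun=> m *+ (if odd q then p.+2 else 0)].
Proof.
rewrite /cyclic_d; case: odd; apply/ffunP => x; rewrite !ffunE ?subrr //.
by under eq_bigr do rewrite ffunE; rewrite sumr_const card_ord.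
Qed.

Lemma cyclic_dd q F : cyclic_d q.+1 (cyclic_d q F) = 0.
Proof.
rewrite /cyclic_d /=; case: odd; apply/ffunP => x; rewrite !ffunE ?subrr //.
under eq_bigr do rewrite ffunE.
by rewrite sumrB [X in _ - X](reindex_inj (addIr 1)) subrr.
Qed.

Lemma cyclic_exact q F : cyclic_d q.+1 F = 0 -> exists E, cyclic_d q E = F.
Proof.
rewrite /cyclic_d /=; case: odd => /= dF.
  exists [ffun x => if x == 0 then F 0 else 0].
  rewrite [RHS](shift_invariant dF); apply/ffunP => x; rewrite !ffunE.
  under eq_bigr do rewrite ffunE.
  by rewrite -big_mkcond big_pred1_eq.
by apply: shift_exact; move/ffunP: dF => /(_ 0); rewrite !ffunE.
Qed.

Lemma translate_trans (x y : 'I_p.+2) : exists g, pi g + x = y.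
Proof.
have /card_gt0P[g] : (0 < #|[set g | pi g == (y - x)%R]|)%N by rewrite card_pi.
by rewrite inE => /eqP gxy; exists g; rewrite gxy subrK.
Qed.

Lemma translate_weight (x : 'I_p.+2) : (\sum_(g : gT) ((pi g + x)%R == 0%R))%N = c.
Proof.
rewrite -(card_pi (- x)) -sum1_card [RHS]big_mkcond.
by apply: eq_bigr => g _; rewrite inE -addr_eq0; case: eqP.
Qed.

(** Kept transparent so that [cell_mult] computes. *)
Definition cyclic_complex : cell_complex gT M c.
Proof.
refine (@CellComplex gT M c (fun=> 'I_p.+2) (fun _ g x => pi g + x) cyclic_d
  (fun q => if odd q then p.+2 else 0%N) (fun _ x => (x == 0 : nat)) (fun=> 0)
  _ _ _ cyclic_d_act cyclic_d_const _ cyclic_dd _ cyclic_exact _) => //.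
- by move=> _ x; rewrite pi1 add0r.
- by move=> _ g h x; rewrite piM addrA.
- by move=> _; exact: translate_trans.
- by move=> F dF; exists (F 0); apply: shift_invariant.
- by move=> _; exact: translate_weight.
Defined.

End CyclicComplex.

(** * The quaternion group and its 4-periodic complex *)

(* (a, b, e) stands for (-1)^e i^a j^b; [qrot] is the automorphism
   i -> j -> k -> i, and [tri] indexes the units i, j, k in this order. *)
Definition quat := (bool * bool * bool)%type.
HB.instance Definition _ := Finite.on quat.

(** The three products in the sign come from $i^2=-1$, $j^2=-1$ and $ji=-ij$. *)
Definition qmul (x y : quat) : quat :=
  let: (a, b, e) := x in let: (a', b', e') := y in
  (a (+) a', b (+) b', e (+) e' (+) (a && a') (+) (b && b') (+) (b && a')).
Definition q1 : quat := (false, false, false).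
Definition qrot (x : quat) : quat := let: (a, b, e) := x in (b, a (+) b, e).

Definition tri := option bool.
Definition tnext (t : tri) : tri :=
  match t with None => Some false | Some false => Some true | Some true => None end.
Definition tprev (t : tri) : tri :=
  match t with None => Some true | Some false => None | Some true => Some false end.
Definition tadd (t u : tri) : tri :=
  match t with None => u | Some false => tnext u | Some true => tprev u end.
Definition qunit (t : tri) : quat :=
  match t with
  | None => (true, false, false) | Some false => (false, true, false)
  | Some true => (true, true, false)
  end.
Definition qtwist (t : tri) (x : quat) : quat :=
  match t with None => x | Some false => qrot x | Some true => qrot (qrot x) end.

Lemma qmulA : associative qmul.
Proof. by do 3!move=> [[[] []] []]. Qed.
Lemma qmul1 : left_id q1 qmul.
Proof. by move=> [[[] []] []]. Qed.
Lemma qmulr1 : right_id q1 qmul.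
Proof. by move=> [[[] []] []]. Qed.
Lemma qtwistM t : {morph qtwist t : x y / qmul x y}.
Proof. by case: t => [[]|]; do 2!move=> [[[] []] []]. Qed.
Lemma qtwist1 t : qtwist t q1 = q1.
Proof. by case: t => [[]|]. Qed.
Lemma qtwistD t u x : qtwist (tadd t u) x = qtwist t (qtwist u x).
Proof. by case: t u x => [[]|] [[]|] [[[] []] []]. Qed.
Lemma qunitD t u : qunit (tadd t u) = qtwist t (qunit u).
Proof. by case: t u => [[]|] [[]|]. Qed.
Lemma taddA : associative tadd.
Proof. by do 3!move=> [[]|]. Qed.
Lemma tadd_next t u : tadd t (tnext u) = tnext (tadd t u).
Proof. by case: t u => [[]|] [[]|]. Qed.

Lemma tadd_prev t u : tadd t (tprev u) = tprev (tadd t u).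
Proof. by case: t u => [[]|] [[]|]. Qed.

Definition tet := (quat * tri)%type.
HB.instance Definition _ := Finite.on tet.

(** The semidirect product of $Q_8$ by the rotation of order 3: the binary tetrahedral group. *)
Definition tet_mul (x y : tet) : tet := (qmul x.1 (qtwist x.2 y.1), tadd x.2 y.2).
Definition tet1 : tet := (q1, None).
Definition qinv (x : quat) : quat := let: (a, b, e) := x in
  (a, b, e (+) a (+) b (+) (a && b)).
Definition topp (t : tri) : tri :=
  match t with None => None | Some b => Some (~~ b) end.
Definition tet_inv (x : tet) : tet :=
  (qtwist (topp x.2) (qinv x.1), topp x.2).

Lemma qmulV : left_inverse q1 qinv qmul.
Proof. by move=> [[[] []] []]. Qed.

Fact tet_mulA : associative tet_mul.
Proof. by move=> x y z; rewrite /tet_mul /= qtwistM qmulA -qtwistD taddA. Qed.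
Fact tet_mul1 : left_id tet1 tet_mul.
Proof. by move=> [[[[] []] []] t]. Qed.
Fact tet_mulV : left_inverse tet1 tet_inv tet_mul.
Proof.
by case=> x t; rewrite /tet_mul /tet_inv /= -qtwistM qmulV qtwist1; case: t => [[]|].
Qed.
HB.instance Definition _ := Finite_isGroup.Build tet tet_mulA tet_mul1 tet_mulV.

(** Unfolds a quantified hypothesis into eight instances usable by [lia]. *)
Lemma quat_all (P : quat -> Prop) : (forall x, P x) ->
  ((P (false, false, false) /\ P (true, false, false)) /\
   (P (false, true, false) /\ P (true, true, false))) /\
  ((P (false, false, true) /\ P (true, false, true)) /\
   (P (false, true, true) /\ P (true, true, true))).
Proof. by []. Qed.

Lemma tri_all (P : tri -> Prop) :
  (forall t, P t) -> P None /\ P (Some false) /\ P (Some true).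
Proof. by []. Qed.

(** * Exactness over the integers for the cells of $Q_8$ *)

Section QuaternionExactness.
Local Open Scope ring_scope.

Ltac split_hyps := repeat match goal with H : _ /\ _ |- _ => destruct H end.

(* The differentials are those of the complex of the presentation
   <i, j, k | ij = k, jk = i, ki = j> of Q_8: the cells of dimension 1 are the edges
   x -- x u_t, those of dimension 2 the triangles x, x u_t, x u_t u_{t+1}, and one
   cell of dimension 3 per element of the group is glued on six triangles. *)
Lemma quat_exact1 (a : quat -> tri -> int) :
    (forall x t, a x t + a (qmul x (qunit t)) (tnext t) - a x (tprev t) = 0) ->
  exists f : quat -> int, forall x t, f (qmul x (qunit t)) - f x = a x t.
Proof.
move=> Ha.
(* Integrate along the paths 1 -- u and 1 -- i -- -1 -- -u. *)
exists (fun x => (if x.2 then a q1 None + a (qunit None) None else 0) + 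
  match x.1 with
  | (true, false) => a (false, false, x.2) None
  | (false, true) => a (false, false, x.2) (Some false)
  | (true, true) => a (false, false, x.2) (Some true)
  | _ => 0 end).
have := quat_all (fun x => tri_all (Ha x)).
rewrite /= /q1 => {}Ha; split_hyps.
by move=> [[[] []] []] [[]|] /=; lia.
Qed.

Lemma quat_exact2 (b : quat -> tri -> int) :
    (forall x, b x None - b (qmul x (qunit (Some true))) None
      + (b x (Some false) - b (qmul x (qunit None)) (Some false))
      + (b x (Some true) - b (qmul x (qunit (Some false))) (Some true)) = 0) ->
  exists a : quat -> tri -> int, forall x t,
    a x t + a (qmul x (qunit t)) (tnext t) - a x (tprev t) = b x t.
Proof.
move=> Hb.
(* Put a = 0 on a spanning tree; each further edge is then the last unknown edge of
   some triangle. *)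
pose t0 : tri := None; pose t1 : tri := Some false; pose t2 : tri := Some true.
pose p1 := b q1; pose m1 := b (false, false, true).
pose pi := b (true, false, false); pose mi := b (true, false, true).
pose pj := b (false, true, false); pose mj := b (false, true, true).
pose pk := b (true, true, false); pose mk := b (true, true, true).
pose sj := pi t2 + pi t0 + p1 t0.
pose si := mj t2 - m1 t1 + mj t1 + sj.
pose sk := mk t1 + pi t0 + m1 t2.
exists (fun x t => match x, t with
  | (false, true, false), None => pj t0 - sk + p1 t1
  | (false, true, false), Some false => p1 t1 - pj t2
  | (false, true, false), Some true => p1 t1
  | (false, true, true), None => sj
  | (false, true, true), Some false => mj t1 + sj
  | (false, true, true), Some true => m1 t1
  | (true, false, false), Some false => p1 t0
  | (true, false, false), Some true => - pi t0
  | (true, false, true), None => si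
  | (true, false, true), Some false => m1 t0
  | (true, false, true), Some true => si - mi t0
  | (true, true, false), None => p1 t2
  | (true, true, false), Some false => pi t1 - p1 t0 - pk t2
  | (true, true, false), Some true => pi t1 - p1 t0
  | (true, true, true), None => m1 t2
  | (true, true, true), Some false => sk
  | (true, true, true), Some true => mk t2 + sk
  | _, _ => 0 end).
have := quat_all Hb.
rewrite /si /sk /sj /p1 /m1 /pi /mi /pj /mj /pk /mk /t0 /t1 /t2 /= /q1 => {}Hb; split_hyps.
by move=> [[[] []] []] [[]|] /=; lia.
Qed.

Lemma sum_quat (f : quat -> int) : \sum_x f x =
  f (true, true, true) + f (true, true, false) +
  (f (true, false, true) + f (true, false, false)) +
  (f (false, true, true) + f (false, true, false) +
  (f (false, false, true) + f (false, false, false))).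
Proof.
rewrite (eq_bigr (fun x => f (x.1, x.2))) => [|[] //].
rewrite -(pair_bigA _ (fun x e => f (x, e))) /=.
rewrite (eq_bigr (fun x => \sum_e f (x.1, x.2, e))) => [|[] //].
by rewrite -(pair_bigA _ (fun x y => \sum_e f (x, y, e))) /= !big_bool.
Qed.

Lemma quat_exact3 (c : quat -> int) : \sum_x c x = 0 ->
  exists b : quat -> tri -> int, forall x,
    b x None - b (qmul x (qunit (Some true))) None
      + (b x (Some false) - b (qmul x (qunit None)) (Some false))
      + (b x (Some true) - b (qmul x (qunit (Some false))) (Some true)) = c x.
Proof.
rewrite sum_quat => Hc.
(* Only the 3-cells along a spanning tree of the dual graph are used. *)
pose s := - c (true, false, true) - c (false, true, true)
  - c (true, true, true) - c (false, false, false).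
exists (fun x t => match x, t with
  | (false, false, e), None => - c (true, true, ~~ e)
  | (false, false, false), Some false => - c (true, false, true)
  | (false, false, true), Some false => s - c (true, false, false)
  | (false, false, e), Some true => - c (false, true, ~~ e)
  | (true, false, false), Some false => s
  | _, _ => 0 end).
by rewrite /s => -[[[] []] []] /=; lia.
Qed.

(** The units generate $Q_8$, so the graph of edges is connected. *)
Lemma quat_exact0 (f : quat -> int) :
  (forall x t, f (qmul x (qunit t)) - f x = 0) -> forall x, f x = f q1.
Proof.
move=> Hf; have := quat_all (fun x => tri_all (Hf x)).
rewrite /= /q1 => {}Hf; split_hyps.
by move=> [[[] []] []] /=; lia.
Qed.
End QuaternionExactness.

(** * The periodic complex with its binary tetrahedral action *)

Section TetrahedralComplex.
Local Open Scope ring_scope.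

Definition quat_d0 (f : {ffun quat -> int}) : {ffun quat * tri -> int} :=
  [ffun x => f (qmul x.1 (qunit x.2)) - f x.1].
(** The third side of the triangle has index [tprev], because $u_t u_{t+1}=u_{t-1}$. *)
Definition quat_d1 (a : {ffun quat * tri -> int}) : {ffun quat * tri -> int} :=
  [ffun x => a x + a (qmul x.1 (qunit x.2), tnext x.2) - a (x.1, tprev x.2)].
Definition quat_d2 (b : {ffun quat * tri -> int}) : {ffun quat -> int} :=
  [ffun x => b (x, None) - b (qmul x (qunit (Some true)), None)
    + (b (x, Some false) - b (qmul x (qunit None), Some false))
    + (b (x, Some true) - b (qmul x (qunit (Some false)), Some true))].

Fact quat_d0_additive : zmod_morphism quat_d0.
Proof. by move=> F G; apply/ffunP=> x; rewrite !ffunE; ring. Qed.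
Fact quat_d1_additive : zmod_morphism quat_d1.
Proof. by move=> F G; apply/ffunP=> x; rewrite !ffunE; ring. Qed.
Fact quat_d2_additive : zmod_morphism quat_d2.
Proof. by move=> F G; apply/ffunP=> x; rewrite !ffunE; ring. Qed.
HB.instance Definition _ := GRing.isZmodMorphism.Build _ _ quat_d0 quat_d0_additive.
HB.instance Definition _ := GRing.isZmodMorphism.Build _ _ quat_d1 quat_d1_additive.
HB.instance Definition _ := GRing.isZmodMorphism.Build _ _ quat_d2 quat_d2_additive.

Fixpoint tet_cell (q : nat) : finType :=
  match q with
  | 0 | 3 => quat : finType
  | 1 | 2 => (quat * tri)%type : finType
  | q'.+4 => tet_cell q'
  end.

(** In degree 3, [total] splices successive copies of the sphere: it sums the top cells and includes
    the result as a constant on vertices. *)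
Fixpoint tet_d (q : nat) :
    {additive {ffun tet_cell q -> int} -> {ffun tet_cell q.+1 -> int}} :=
  match q with
  | 0 => quat_d0 | 1 => quat_d1 | 2 => quat_d2 | 3 => @total int quat quat
  | q'.+4 => tet_d q'
  end.

Fixpoint tet_mult (q : nat) : nat :=
  match q with 0 | 2 => 0 | 1 => 1 | 3 => 8 | q'.+4 => tet_mult q' end.

Definition quat_act (y : tet) (x : quat) : quat := qmul y.1 (qtwist y.2 x).
Definition pair_act (y : tet) (x : quat * tri) : quat * tri :=
  (quat_act y x.1, tadd y.2 x.2).

Fixpoint tet_act (q : nat) (y : tet) : tet_cell q -> tet_cell q :=
  match q with
  | 0 | 3 => quat_act y | 1 | 2 => pair_act y | q'.+4 => @tet_act q' y
  end.

(** All three pairs over [q1] have weight 1, so edges and triangles give the same count as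
    vertices. *)
Fixpoint tet_weight (q : nat) : tet_cell q -> nat :=
  match q with
  | 0 | 3 => fun x : quat => x == q1 : nat
  | 1 | 2 => fun x : quat * tri => x.1 == q1 : nat
  | q'.+4 => @tet_weight q'
  end.

Fixpoint tet_pt (q : nat) : tet_cell q :=
  match q with 0 | 3 => q1 | 1 | 2 => (q1, None) | q'.+4 => tet_pt q' end.

Lemma nat_ind4 (P : nat -> Prop) :
  P 0 -> P 1 -> P 2 -> P 3 -> (forall q, P q -> P q.+4) -> forall q, P q.
Proof. by move=> P0 P1 P2 P3 P4; fix IH 1 => -[|[|[|[|q]]]]; [..|apply/P4/IH]. Qed.

Lemma quat_act_mul y z x : quat_act (y * z)%g x = quat_act y (quat_act z x).
Proof. by rewrite /quat_act /= qtwistD qtwistM qmulA. Qed.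

(** Source of equivariance: left translation commutes with right multiplication, and a rotation only
    shifts the index of the unit. *)
Lemma quat_act_unit y x t :
  quat_act y (qmul x (qunit t)) = qmul (quat_act y x) (qunit (tadd y.2 t)).
Proof. by rewrite /quat_act qtwistM qunitD qmulA. Qed.

Lemma tet_act1 q (x : tet_cell q) : tet_act 1%g x = x.
Proof.
elim/nat_ind4: q x => [x|[x t]|[x t]|x|q IH x] /=; try exact: qmul1; last exact: IH.
all: by congr (_, _); apply: qmul1.
Qed.

Lemma tet_actM q y z (x : tet_cell q) :
  tet_act (y * z)%g x = tet_act y (tet_act z x).
Proof.
elim/nat_ind4: q x => [x|x|x|x|q IH x] /=; try exact: quat_act_mul; last exact: IH.
all: by rewrite /pair_act quat_act_mul /= taddA.
Qed.

Lemma tet_trans q (x x' : tet_cell q) : exists y, tet_act y x = x'.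
Proof.
have quat_trans (u v : quat) : quat_act (qmul v (qinv u), None) u = v.
  by rewrite /quat_act /= -qmulA qmulV qmulr1.
have pair_trans (u v : quat * tri) : exists y, pair_act y u = v.
  have tri_trans t t' : exists s, tadd s t = t'.
    by case: t t' => [[]|] [[]|]; [exists None|exists (Some true)|exists (Some false)
      |exists (Some false)|exists None|exists (Some true)
      |exists (Some true)|exists (Some false)|exists None].
  case: u v => u t [v t']; have [s st] := tri_trans t t'.
  exists (qmul v (qinv (qtwist s u)), s).
  by rewrite /pair_act /quat_act /= st -qmulA qmulV qmulr1.
elim/nat_ind4: q x x' => [x x'|x x'|x x'|x x'|q IH x x'] //=; first by eexists; apply: quat_trans.
by eexists; apply: quat_trans.
Qed.

Lemma tet_d_act q y (F : {ffun tet_cell q -> int}) :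
  tet_d q [ffun x => F (tet_act y x)] = [ffun x => tet_d q F (tet_act y x)].
Proof.
have next_act x t : pair_act y (qmul x (qunit t), tnext t) =
    (qmul (quat_act y x) (qunit (tadd y.2 t)), tnext (tadd y.2 t)).
  by congr (_, _); [apply: quat_act_unit | apply: tadd_next].
have prev_act x t : pair_act y (x, tprev t) = (quat_act y x, tprev (tadd y.2 t)).
  by congr (_, _); apply: tadd_prev.
elim/nat_ind4: q F => [F|F|F|F|q IH F]; last exact: IH.
- by apply/ffunP => x; rewrite !ffunE; congr (F _ - _); apply: quat_act_unit.
- apply/ffunP => x; rewrite !ffunE.
  by congr (_ + F _ - F _); [apply: next_act | apply: prev_act].
- apply/ffunP => x; rewrite !ffunE.
  have quat_unit_act t u : pair_act y (qmul x (qunit t), u) =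
      (qmul (quat_act y x) (qunit (tadd y.2 t)), tadd y.2 u).
    by congr (_, _); apply: quat_act_unit.
  rewrite -[LHS]/(F (pair_act y (x, None))
        - F (pair_act y (qmul x (qunit (Some true)), None))
      + (F (pair_act y (x, Some false))
        - F (pair_act y (qmul x (qunit None), Some false)))
      + (F (pair_act y (x, Some true))
        - F (pair_act y (qmul x (qunit (Some false)), Some true)))).
  rewrite !quat_unit_act; rewrite /pair_act -[tet_act y x]/(quat_act y x).
  move: (quat_act y x) => u /=.
  (* The rotation permutes the three differences cyclically. *)
  by case: y.2 => [[]|]; rewrite /=; ring.
- apply/ffunP => x; rewrite !ffunE [RHS](reindex_inj (h := quat_act y)) /=.
    by apply: eq_bigr => z _; rewrite ffunE.
  apply: (can_inj (g := quat_act y^-1%g)) => z.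
  by rewrite -quat_act_mul mulVg; apply: qmul1.
Qed.

Lemma tet_d_const q (m : int) : tet_d q [ffun=> m] = [ffun=> m *+ tet_mult q].
Proof.
elim/nat_ind4: q => [||||q IH]; last exact: IH.
- by apply/ffunP => x; rewrite !ffunE subrr.
- by apply/ffunP => x; rewrite !ffunE addrK.
- by apply/ffunP => x; rewrite !ffunE !subrr.
- by apply/ffunP => x; rewrite !ffunE sum_quat !ffunE /=; ring.
Qed.

Lemma tet_dd q F : tet_d q.+1 (tet_d q F) = 0.
Proof.
elim/nat_ind4: q F => [F|F|F|F|q IH F]; last exact: IH.
- by apply/ffunP => -[[[[] []] []] [[]|]]; rewrite !ffunE /=; ring.
- by apply/ffunP => -[[[] []] []]; rewrite !ffunE /=; ring.
- by apply/ffunP => x; rewrite !ffunE sum_quat !ffunE /=; ring.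
- by apply/ffunP => x; rewrite !ffunE subrr.
Qed.

Lemma tet_exact q F : tet_d q.+1 F = 0 -> exists E, tet_d q E = F.
Proof.
elim/nat_ind4: q F => [F|F|F|F|q IH F]; last exact: IH.
- move=> /ffunP dF; have [|f Hf] := quat_exact1 (a := fun x t => F (x, t)).
    by move=> x t; have := dF (x, t); rewrite !ffunE.
  by exists [ffun x => f x]; apply/ffunP => -[x t]; rewrite !ffunE Hf.
- move=> /ffunP dF; have [|a Ha] := quat_exact2 (b := fun x t => F (x, t)).
    by move=> x; have := dF x; rewrite !ffunE.
  by exists [ffun x => a x.1 x.2]; apply/ffunP => -[x t]; rewrite !ffunE Ha.
- move=> /ffunP dF; have [|b Hb] := quat_exact3 (c := F).
    by have := dF q1; rewrite !ffunE.
  by exists [ffun x => b x.1 x.2]; apply/ffunP => x; rewrite !ffunE Hb.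
- move=> /ffunP dF; have Hf : forall x, F x = F q1.
    apply: quat_exact0.
    by move=> x t; have := dF (x, t); rewrite !ffunE.
  (* A constant is the total of a function concentrated at [q1]. *)
  exists [ffun x => if x == q1 then F q1 else 0]; apply/ffunP => x.
  rewrite !ffunE (Hf x); under eq_bigr do rewrite ffunE.
  by rewrite -big_mkcond big_pred1_eq.
Qed.

Section Action.
Variables (gT : finGroupType) (c : nat) (phi : gT -> tet).
Hypothesis phiM : forall g h, phi (g * h)%g = (phi g * phi h)%g.
Hypothesis phi_surj : forall y, exists g, phi g = y.
Hypothesis card_phi : forall x, #|[set g | (phi g).1 == x]| = c.

Lemma phi1 : phi 1%g = 1%g.
Proof. by apply: (mulgI (phi 1%g)); rewrite -phiM !mulg1. Qed.

Lemma tet_weight_sum q (x : tet_cell q) : (\sum_g tet_weight (tet_act (phi g) x))%N = c.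
Proof.
have quat_weight (u : quat) : (\sum_g (quat_act (phi g) u == q1))%N = c.
  rewrite -(card_phi u) -sum1_card [RHS]big_mkcond (reindex_inj invg_inj) /=.
  apply: eq_bigr => g _; rewrite inE.
  (* [(phi g).1] is the image of [q1] under [phi g]. *)
  have -> : (quat_act (phi g^-1%g) u == q1) = ((phi g).1 == u).
    have act_q1 y : quat_act y q1 = y.1 by rewrite /quat_act qtwist1 qmulr1.
    apply/eqP/eqP => [eq1|<-].
      by rewrite -act_q1 -eq1 -quat_act_mul -phiM mulgV phi1; apply: qmul1.
    by rewrite -[(phi g).1]act_q1 -quat_act_mul -phiM mulVg phi1.
  by case: eqP.
elim/nat_ind4: q x => [x|x|x|x|q IH x] /=; try exact: quat_weight; exact: IH.
Qed.

Definition tet_complex : cell_complex gT int c.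
Proof.
refine (@CellComplex gT int c tet_cell (fun q g => @tet_act q (phi g)) tet_d
  tet_mult tet_weight tet_pt _ _ _ (fun q g => @tet_d_act q (phi g)) tet_d_const _
  tet_dd _ tet_exact tet_weight_sum) => //.
- by move=> q x; rewrite phi1 tet_act1.
- by move=> q g h x; rewrite phiM tet_actM.
- move=> q x x'; have [y <-] := tet_trans x x'.
  by have [g <-] := phi_surj y; exists g.
- move=> F /ffunP dF; exists (F q1).
  have Hf : forall x, F x = F q1.
    apply: quat_exact0.
    by move=> x t; have := dF (x, t); rewrite !ffunE.
  by apply/ffunP => x; rewrite ffunE (Hf x).
Defined.
End Action.
End TetrahedralComplex.

(** * The quotients of the group *)

Section GroupStructure.
Local Open Scope group_scope.

(** Left multiplication carries any fibre onto any other. The target need only be a set with action,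
    which covers the map to $Q_8$, not a morphism. *)
Lemma card_fiber (gT : finGroupType) (X : finType) (act : gT -> X -> X) (pr : gT -> X) x :
    (forall h g, pr (h * g) = act h (pr g)) -> (forall y, exists g, pr g = y) ->
  (#|[set g | pr g == x]| * #|X|)%N = #|gT|.
Proof.
move=> prM pr_surj; rewrite -[RHS]sum1_card (partition_big pr predT) //=.
rewrite mulnC -sum_nat_const; apply: eq_bigr => y _.
have [g0 gx] := pr_surj x; have [g1 gy] := pr_surj y.
rewrite -sum1dep_card [RHS](reindex_inj (mulgI (g1 * g0^-1))).
apply: eq_bigl => g /=; apply/eqP/eqP => [prx|].
  by rewrite prM prx -gx -prM mulgKV gy.
move=> /(congr1 (act (g0 * g1^-1))); rewrite -prM -gy -prM !mulgKV gx => <-.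
by rewrite mulgA mulgA mulgKV mulgV mul1g.
Qed.

Lemma homg_surjection (gT rT : finGroupType) : [set: rT] \homg [set: gT] ->
  exists2 f : gT -> rT, (forall x y, f (x * y) = f x * f y) &
    forall y, exists x, f x = y.
Proof.
case/homgP=> f im_f; exists f => [x y|y]; first by rewrite morphM ?inE.
have : y \in [set: rT] by rewrite inE.
by rewrite -im_f => /morphimP[x _ _ ->]; exists x.
Qed.

(** * Upper bound on the order from the relations *)

Section Bound.
Variables (gT : finGroupType) (p q z : gT) (m : nat).
Hypothesis p2 : p ^+ 2 = q ^+ 2.
Hypothesis pq2 : (p * q) ^+ 2 = q ^+ 2.
Hypothesis zp : z * p * z^-1 = q.
Hypothesis zq : z * q * z^-1 = p * q.
Hypothesis zm : z ^+ m = 1.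
Hypothesis m_gt0 : 0 < m.

Let conj_pq : p ^ q = p^-1.
Proof.
have pqp : p * q * p = q.
  by apply: (mulIg q); rewrite -[RHS]/(q ^+ 2) -pq2 expgS expg1 !mulgA.
by rewrite conjgE; apply: (mulgI q); rewrite mulKVg; apply: (mulIg p); rewrite pqp mulgKV.
Qed.

Lemma card_join_quaternion : #|<[p]> <*> <[q]>| <= 8.
Proof.
rewrite -[8]/(2 ^ 3)%N -(card_quaternion (isT : 2 < 3)); apply: leq_homg.
rewrite (Grp_quaternion (isT : 2 < 3)); apply/existsP; exists (p, q) => /=.
rewrite !xpair_eqE eqxx conj_pq eqxx p2 eqxx !andbT /=.
(* Conjugation by [q] fixes $p^2=q^2$ and also inverts it, whence $p^4=1$. *)
have : (p ^+ 2) ^ q = p ^+ 2 by rewrite p2 conjgE -expgSr expgS mulKg.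
by rewrite conjXg conj_pq => pV; rewrite (expgD p 2 2) -{1}pV expgVn mulVg.
Qed.

(** The relations make [z] normalise the subgroup generated by [p] and [q], so the group is a
    product of the two. *)
Lemma card_generated : <[p]> <*> <[q]> <*> <[z]> = [set: gT] -> #|gT| <= 8 * m.
Proof.
move=> gen; rewrite -cardsT -gen.
have zN : <[z]> \subset 'N(<[p]> <*> <[q]>).
  rewrite cycle_subG -groupV inE -genJ gen_subG conjUg subUset -!cycleJ !cycle_subG.
  rewrite !conjgE !invgK !mulgA zp zq.
  by rewrite groupM ?mem_gen // !inE ?cycle_id ?orbT.
rewrite norm_joinEr //; apply: (@leq_trans (#|<[p]> <*> <[q]>| * #|<[z]>|)).
  by rewrite mul_cardG leq_pmulr // cardG_gt0.
by rewrite leq_mul ?card_join_quaternion // dvdn_leq // order_dvdn zm.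
Qed.
End Bound.

Lemma cyclic_homg p n : n = p.+2 -> [set: 'I_p.+2] \homg Grp (x : y : z :
  x ^+ 2 = (x * y) ^+ 2 = y ^+ 2, z * x * z^-1 = y, z * y * z^-1 = x * y, z ^+ n = 1).
Proof.
move->; apply/existsP; exists (1%g, 1%g, Zp1) => /=; rewrite !xpair_eqE.
rewrite cycle1 !joing1G !mulg1 !mulgV !expg1n !eqxx /=.
rewrite -(Zp_cycle p.+1) eqxx FinRing.zmodXgE; apply/eqP; exact: (@pchar_Zp p.+2 isT).
Qed.

Lemma tet_homg s : (0 < s)%N -> [set: tet] \homg Grp (x : y : z :
  x ^+ 2 = (x * y) ^+ 2 = y ^+ 2, z * x * z^-1 = y, z * y * z^-1 = x * y, z ^+ (3 ^ s) = 1).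
Proof.
move=> s_gt0.
pose p : tet := (qunit None, None); pose q : tet := (qunit (Some false), None).
pose z : tet := (q1, Some false).
apply/existsP; exists (p, q, z) => /=; rewrite !xpair_eqE.
have -> : z ^+ (3 ^ s) = 1 by rewrite -(prednK s_gt0) expnS expgM (_ : z ^+ 3 = 1) ?expg1n.
rewrite eqxx !andbT.
apply/eqP/setP => x; rewrite inE.
(* Normal form $i^a j^b (-1)^e z^t$, with $-1=p^2$. *)
have -> : x = p ^+ (x.1.1.1 : nat) * q ^+ (x.1.1.2 : nat) * p ^+ (2 * x.1.2) *
   z ^+ (if x.2 is Some b then b.+1 else 0).
  by case: x => [[[[] []] []] [[]|]].
have pJ : p \in <[p]> <*> <[q]> <*> <[z]>.
  rewrite (subsetP (joing_subl (<[p]> <*> <[q]>) <[z]>)) //.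
  by rewrite (subsetP (joing_subl <[p]> <[q]>)) ?cycle_id.
have qJ : q \in <[p]> <*> <[q]> <*> <[z]>.
  rewrite (subsetP (joing_subl (<[p]> <*> <[q]>) <[z]>)) //.
  by rewrite (subsetP (joing_subr <[p]> <[q]>)) ?cycle_id.
have zJ : z \in <[p]> <*> <[q]> <*> <[z]> by rewrite -cycle_subG joing_subr.
by rewrite !(groupM, groupX).
Qed.

Section Projections.
Variables (s : nat) (gT : finGroupType).
Hypothesis s_gt0 : (0 < s)%N.
Hypothesis hG : [set: gT] \isog Grp (p : q : z :
  p ^+ 2 = (p * q) ^+ 2 = q ^+ 2, z * p * z^-1 = q, z * q * z^-1 = p * q,
  z ^+ (3 ^ s) = 1).

Let m_gt1 : 1 < 3 ^ s.
Proof. by rewrite -(exp1n s) ltn_exp2r. Qed.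

Let card_Zm : #|'Z_(3 ^ s)| = (3 ^ s)%N.
Proof. by rewrite card_ord Zp_cast. Qed.

Lemma cyclic_projection : exists2 pi : gT -> 'Z_(3 ^ s),
  forall g h, pi (g * h) = (pi g + pi h)%R & forall x, exists g, pi g = x.
Proof.
have [|pi piM pi_surj] := @homg_surjection gT 'Z_(3 ^ s).
  by rewrite hG; apply: cyclic_homg; rewrite Zp_cast.
by exists pi.
Qed.

Lemma tet_projection : exists2 phi : gT -> tet,
  forall g h, phi (g * h) = phi g * phi h & forall x, exists g, phi g = x.
Proof. by apply: homg_surjection; rewrite hG; apply: tet_homg. Qed.

(** The order is divisible by 8 through the tetrahedral quotient and by $3^s$ through the cyclic
    one, which are coprime; the relations bound it above. *)
Lemma card_binary : #|gT| = (8 * 3 ^ s)%N.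
Proof.
have [pi piM pi_surj] := cyclic_projection.
have [phi phiM phi_surj] := tet_projection.
apply/eqP; rewrite eqn_leq; apply/andP; split.
  case/existsP: (isoGrp_hom hG) => -[[p q] z] /= /eqP[gen p2 pq2 zp zq zm].
  exact: card_generated p2 pq2 zp zq zm (ltnW m_gt1) gen.
apply: dvdn_leq; first by apply/card_gt0P; exists 1%g.
rewrite Gauss_dvd ?coprimeXr //; apply/andP; split.
  rewrite -(@card_fiber gT tet (fun g => mulg (phi g)) phi 1%g phiM phi_surj) dvdn_mull //.
  by rewrite !card_prod card_bool card_option card_bool.
rewrite -(@card_fiber gT 'Z_(3 ^ s) (fun g x => pi g + x)%R pi 0%R piM pi_surj).
by rewrite card_Zm dvdn_mull.
Qed.

Lemma card_cyclic_fiber (pi : gT -> 'Z_(3 ^ s)) x :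
    (forall g h, pi (g * h) = (pi g + pi h)%R) -> (forall y, exists g, pi g = y) ->
  #|[set g | pi g == x]| = 8.
Proof.
move=> piM pi_surj; apply/eqP.
rewrite -(eqn_pmul2r (ltnW m_gt1)) -card_binary.
rewrite -(@card_fiber gT 'Z_(3 ^ s) (fun g x => pi g + x)%R pi x piM pi_surj).
by rewrite card_Zm.
Qed.

Lemma card_quat_fiber (phi : gT -> tet) x :
    (forall g h, phi (g * h) = phi g * phi h) -> (forall y, exists g, phi g = y) ->
  #|[set g | (phi g).1 == x]| = (3 ^ s)%N.
Proof.
move=> phiM phi_surj; apply/eqP; rewrite -(eqn_pmul2r (isT : 0 < 8)).
rewrite [(3 ^ s * 8)%N]mulnC -card_binary.
rewrite -(@card_fiber gT quat (fun g => quat_act (phi g)) (fun g => (phi g).1) x) //.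
- by rewrite !card_prod card_bool.
- by move=> h g; rewrite phiM.
by move=> y; have [g gy] := phi_surj (y, None); exists g; rewrite gy.
Qed.
End Projections.
End GroupStructure.

(** * Combining the two complexes *)

Section Assembly.
Local Open Scope ring_scope.

Lemma coboundMB (gT : finGroupType) (M : zmodType) n (f g : cochain gT M) u v s :
  cobound n (fun t => f t *+ u - g t *+ v) s =
  cobound n f s *+ u - cobound n g s *+ v.
Proof.
rewrite /cobound -!sumrMnl -sumrB; apply: eq_bigr => i _.
by case: odd; rewrite // !mulNrn opprD.
Qed.

Lemma cocycleMB (gT : finGroupType) (M : zmodType) n (f g : cochain gT M) u v :
  cocycle n f -> cocycle n g -> cocycle n (fun t => f t *+ u - g t *+ v).
Proof. by move=> fZ gZ s ss; rewrite coboundMB fZ // gZ // !mul0rn subrr. Qed.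

Lemma coprime_bezout a b : (0 < a)%N -> coprime a b ->
  exists u v, (u * a)%N = (v * b + 1)%N.
Proof.
move=> a_gt0 /eqP co_ab; have [u v def _] := egcdnP b a_gt0.
by exists u, v; rewrite def co_ab.
Qed.

Lemma coboundary_coprime (gT : finGroupType) (M : zmodType) n (f : cochain gT M) a b :
    (0 < a)%N -> coprime a b ->
    coboundary n.+1 (fun s => f s *+ a) -> coboundary n.+1 (fun s => f s *+ b) ->
  coboundary n.+1 f.
Proof.
move=> a_gt0 co_ab [h fh] [k fk]; have [u [v uv]] := coprime_bezout a_gt0 co_ab.
exists (fun s => h s *+ u - k s *+ v) => s ss.
rewrite coboundMB -fh // -fk // -!mulrnA ![(_ * u)%N]mulnC ![(_ * v)%N]mulnC.
by rewrite uv addn1 mulrS addrK.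
Qed.

Lemma Zp_intr_eq0 N (k : int) : (1 < N)%N -> (k%:~R == 0 :> 'Z_N) = (N %| k)%Z.
Proof.
move=> N_gt1; have nat_case n : (n%:R == 0 :> 'Z_N) = (N %| n)%N.
  by rewrite -val_eqE /= val_Zp_nat.
rewrite dvdzE; case: k => n; first exact: nat_case.
by rewrite NegzE rmorphN oppr_eq0 abszN; apply: nat_case.
Qed.

(** * Chinese remainders from two complexes with coprime factors *)

Section TwoComplexes.
Variables (gT : finGroupType) (c1 c2 n : nat).
Variables (K1 : cell_complex gT int c1) (K2 : cell_complex gT int c2).
Hypotheses (c1_gt0 : (0 < c1)%N) (c2_gt0 : (0 < c2)%N) (co_c : coprime c1 c2).

Lemma coboundary_two_complexes f m1 m2 : cocycle n.+1 f ->
    edge_map K1 n f = m1 *+ cell_mult K1 n -> edge_map K2 n f = m2 *+ cell_mult K2 n ->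
  coboundary n.+1 f.
Proof.
move=> fZ /(coboundary_edge_map fZ)[k1 f1] /(coboundary_edge_map fZ)[k2 f2].
by apply: (coboundary_coprime _ _ f1 f2); rewrite ?expn_gt0 ?c1_gt0 ?coprimeXl ?coprimeXr.
Qed.

(** A positive multiple of each edge is zero, and the integers are torsion-free. *)
Lemma cohom_zero_two_complexes :
  (0 < cell_mult K1 n.+1)%N -> (0 < cell_mult K2 n.+1)%N -> cohom_zero gT int n.+1.
Proof.
move=> m1_gt0 m2_gt0 f fZ; apply: (coboundary_two_complexes (m1 := 0) (m2 := 0) fZ).
  apply/eqP; have /eqP := edge_map_cocycle K1 fZ.
  by rewrite mul0rn !mulrn_eq0 !eqn0Ngt c1_gt0 m1_gt0.
apply/eqP; have /eqP := edge_map_cocycle K2 fZ.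
by rewrite mul0rn !mulrn_eq0 !eqn0Ngt c2_gt0 m2_gt0.
Qed.

(** The edges matter modulo [m1] and [m2]; [chi] merges both residues into one modulo [m2 * m1]. *)
Lemma cohom_iso_two_complexes m1 m2 :
    cell_mult K1 n = m1 -> cell_mult K2 n = m2 ->
    cell_mult K1 n.+1 = 0%N -> cell_mult K2 n.+1 = 0%N ->
    coprime m1 m2 -> coprime c1 m1 -> coprime c2 m2 -> (0 < m2)%N -> (1 < m2 * m1)%N ->
  cohom_iso gT int 'Z_(m2 * m1) n.+1.
Proof.
move=> m1E m2E z1 z2 co_m co_cm1 co_cm2 m2_gt0 m_gt1.
pose chi f : int := edge_map K1 n f *+ m2 + edge_map K2 n f *+ m1.
have chiMB f g u v : chi (fun s => f s *+ u - g s *+ v) = chi f *+ u - chi g *+ v.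
  rewrite /chi !edge_mapB !edge_mapMn !mulrnBl !mulrnDl opprD addrACA.
  by rewrite -!mulrnA ![(u * _)%N]mulnC ![(v * _)%N]mulnC.
have mulnz (x : int) k : x *+ k = x * k%:Z by rewrite -mulr_natr natz.
have chiE f : chi f = edge_map K1 n f * m2%:Z + edge_map K2 n f * m1%:Z.
  by rewrite /chi !mulnz.
have chi_eq0 f : (chi f)%:~R = 0 :> 'Z_(m2 * m1) <->
    (exists x, edge_map K1 n f = x *+ m1) /\ (exists y, edge_map K2 n f = y *+ m2).
  have co12 : coprimez m1 m2 by rewrite coprimezE.
  have co21 : coprimez m2 m1 by rewrite coprimezE coprime_sym.
  split=> [/eqP|[[x fx] [y fy]]].
    rewrite Zp_intr_eq0 // PoszM Gauss_dvdz //.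
    rewrite chiE => /andP[dv2 dv1].
    have /dvdzP[y fy] : (m2%:Z %| edge_map K2 n f)%Z.
      rewrite -(Gauss_dvdzl _ co21).
      by have := rpredB dv2 (dvdz_mull (edge_map K1 n f) (dvdzz m2));
        rewrite [X in X - _]addrC addrK.
    have /dvdzP[x fx] : (m1%:Z %| edge_map K1 n f)%Z.
      rewrite -(Gauss_dvdzl _ co12).
      by have := rpredB dv1 (dvdz_mull (edge_map K2 n f) (dvdzz m1)); rewrite addrK.
    split; [exists x | exists y].
      by rewrite fx mulnz.
    by rewrite fy mulnz.
  apply/eqP; rewrite Zp_intr_eq0 // chiE fx fy !mulnz -!mulrA -[(m1%:Z * _)%R]mulrC -mulrDl.
  by rewrite PoszM dvdz_mull.
exists (fun f => (chi f)%:~R); split.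
- move=> f g _ _; rewrite -rmorphB; congr (_%:~R).
  have := chiMB f g 1%N 1%N; rewrite !mulr1n => <-; rewrite /chi.
  by congr (_ *+ _ + _ *+ _); apply: eq_edge_map => s; rewrite !mulr1n.
- move=> a.
  have [|f1 f1Z [x fx]] := @edge_map_surj _ _ _ K1 n 1; first by rewrite z1 mulr0n.
  have [|f2 f2Z [y fy]] := @edge_map_surj _ _ _ K2 n 1; first by rewrite z2 mulr0n.
  (* In [chi], [f1 *+ m2] and [f2 *+ m1] have known parts $c_1^{n+2}m_2^2$ and $c_2^{n+2}m_1^2$; all
     unknown parts become multiples of [m2 * m1]. Bezout then reaches 1. *)
  have [||u [v uv]] := @coprime_bezout (c1 ^ n.+2 * m2 ^ 2) (c2 ^ n.+2 * m1 ^ 2).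
  - by rewrite muln_gt0 !expn_gt0 c1_gt0 m2_gt0.
  - have coX b d k l : coprime b d -> coprime (b ^ k) (d ^ l).
      by move=> co_bd; rewrite coprimeXl // coprimeXr.
    by rewrite coprimeMl; apply/andP; split; rewrite coprimeMr; apply/andP; split;
      apply: coX => //; rewrite coprime_sym.
  exists (fun s => f1 s *+ (m2 * u * a) - f2 s *+ (m1 * v * a)).
  split; first exact: cocycleMB.
  rewrite chiMB !chiE fx fy m1E m2E !mulnz !mul1r.
  have {uv}uv : u%:Z * ((c1 ^ n.+2)%N%:Z * (m2%:Z * m2%:Z)) =
                v%:Z * ((c2 ^ n.+2)%N%:Z * (m1%:Z * m1%:Z)) + 1.
    by rewrite -!PoszM -PoszD uv !mulnn.
  set e12 := edge_map K1 n f2; set e21 := edge_map K2 n f1.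
  set C1 := (c1 ^ n.+2)%N%:Z in uv *; set C2 := (c2 ^ n.+2)%N%:Z in uv *.
  rewrite !PoszM.
  transitivity ((a%:Z + (x * m2%:Z * u%:Z * a%:Z + e21 * u%:Z * a%:Z
    - e12 * v%:Z * a%:Z - y * m1%:Z * v%:Z * a%:Z) * (m2 * m1)%N%:Z)%:~R : 'Z_(m2 * m1)).
    by congr (_%:~R); rewrite PoszM; ring: uv.
  rewrite rmorphD rmorphM /= -[(m2 * m1)%N%:~R]/((m2 * m1)%N%:R) pchar_Zp // mulr0 addr0.
  exact: natr_Zp.
- move=> f fZ; rewrite chi_eq0; split.
    rewrite -m1E -m2E => -[[x fx] [y fy]].
    exact: coboundary_two_complexes fZ fx fy.
  by rewrite -m1E -m2E => fB; split; apply: edge_map_coboundary.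
Qed.
End TwoComplexes.

(** As $8\equiv-1$ modulo 3, multiplication by a power of 8 is its own inverse. *)
Lemma Z3_mulrn (x : 'Z_3) k : x *+ (8 ^ k) *+ (8 ^ k) = x.
Proof.
have x64 : x *+ 8 *+ 8 = x by case: x => [[|[|[|]]]] //= lt_x; apply/val_inj.
rewrite -mulrnA -expnMn; elim: k => [|k IH]; first by rewrite mulr1n.
by rewrite expnS !mulrnA x64.
Qed.

(** All multiplicities vanish in ['Z_3] and the factor 8 is invertible there, so a single complex
    suffices. *)
Lemma cohom_iso_Z3 (gT : finGroupType) (K : cell_complex gT 'Z_3 8) n :
    (forall q, 3 %| cell_mult K q)%N -> cohom_iso gT 'Z_3 'Z_3 n.+1.
Proof.
move=> dv3; have mult0 (x : 'Z_3) q : x *+ cell_mult K q = 0.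
  have /dvdnP[k ->] := dv3 q; rewrite mulnC mulrnA.
  by rewrite -(mulr_natr x 3) (@pchar_Zp 3) // mulr0 mul0rn.
exists (edge_map K n); split=> [f g _ _|a|f fZ].
- exact: edge_mapB.
- have [|f fZ [x fx]] := @edge_map_surj _ _ _ K n (a *+ (8 ^ n.+2)).
    exact: mult0.
  by exists f; rewrite fx mult0 addr0 Z3_mulrn.
split=> [f0|/edge_map_coboundary-/(_ _ K)[x ->]]; last exact: mult0.
have [|k [h fh]] := @coboundary_edge_map _ _ _ K n f 0 fZ; first by rewrite mul0rn.
(* The zero term only gives the shape required by [coboundMB]. *)
exists (fun s => h s *+ (8 ^ k) - h s *+ 0) => s ss.
by rewrite coboundMB -fh // mulr0n subr0 Z3_mulrn.
Qed.

Lemma cohom_iso0 (gT : finGroupType) (M : zmodType) : cohom_iso gT M M 0.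
Proof.
exists (fun f => f [::]); split=> // [a|f _].
  exists (fun=> a); split=> // s ss.
  by rewrite /cobound !big_ord_recl big_ord0 /= addr0 subrr.
by split=> [f0 s /size0nil ->|f0] //; apply: f0.
Qed.

End Assembly.

Lemma tet_mult_mod k j : tet_mult (4 * k + j) = tet_mult j.
Proof. by elim: k => // k IH; rewrite mulnS -addnA. Qed.

Lemma odd_4mulD k j : odd (4 * k + j) = odd j.
Proof. by rewrite oddD oddM. Qed.

Theorem theorem10p7 (s : nat) (gT : finGroupType)
  (hs : (2 <= s)%N)
  (hG : ([set: gT] \isog
          Grp (p : q : z : p ^+ 2 = (p * q) ^+ 2 = q ^+ 2,
                           z * p * z^-1 = q, z * q * z^-1 = p * q,
                           z ^+ (3 ^ s) = 1))%g) :
  cohom_iso gT int int 0 /\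
  (forall k : nat,
     [/\ (0 < k)%N -> cohom_iso gT int 'Z_(8 * 3 ^ s) (4 * k),
         cohom_zero gT int (4 * k).+1,
         cohom_iso gT int 'Z_(3 ^ s) (4 * k).+2 &
         cohom_zero gT int (4 * k).+3]) /\
  (forall j : nat, cohom_iso gT 'Z_3 'Z_3 j).
Proof.
have s_gt0 : 0 < s by apply: ltnW.
have m_gt0 : 0 < 3 ^ s by rewrite expn_gt0.
have m_gt1 : 1 < 3 ^ s by rewrite -(exp1n s) ltn_exp2r.
have [pi piM pi_surj] := cyclic_projection s_gt0 hG.
have [phi phiM phi_surj] := tet_projection s_gt0 hG.
have card_pi x := card_cyclic_fiber s_gt0 hG x piM pi_surj.
have card_phi x := card_quat_fiber s_gt0 hG x phiM phi_surj.
pose C M : cell_complex gT M 8 := @cyclic_complex gT M _ _ pi piM card_pi isT.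
pose T := tet_complex phiM phi_surj card_phi.
have multC M q : cell_mult (C M) q = if odd q then 3 ^ s else 0.
  by rewrite /= Zp_cast.
have multT k j : cell_mult T (4 * k + j) = tet_mult j := tet_mult_mod k j.
have co83 : coprime 8 (3 ^ s) by rewrite coprimeXr.
(* The cyclic complex contributes $3^s$, the tetrahedral one [r], equal to 8 or 1 according to the
   degree modulo 4. *)
have iso_even n r : odd n -> cell_mult T n = r -> cell_mult T n.+1 = 0 ->
    0 < r -> coprime (3 ^ s) r -> cohom_iso gT int 'Z_(r * 3 ^ s) n.+1.
  move=> n_odd Tr T0 r_gt0 co_r.
  apply: (cohom_iso_two_complexes (K1 := C int) (K2 := T)) => //.
  - by rewrite multC n_odd.
  - by rewrite multC /= n_odd.
  - by rewrite (leq_trans m_gt1) ?leq_pmull.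
have zero_odd n : ~~ odd n -> 0 < cell_mult T n.+1 -> cohom_zero gT int n.+1.
  move=> n_even; apply: (cohom_zero_two_complexes (K1 := C int)) => //.
  by rewrite multC /= n_even.
split; first exact: cohom_iso0.
split=> [k|[|j]]; last 2 first.
- exact: cohom_iso0.
- apply: (cohom_iso_Z3 (K := C _)) => q; rewrite multC; case: odd => //.
  by rewrite dvdn_exp.
split.
- case: k => // k _; rewrite mulnS addnC (addnS _ 3).
  apply: (iso_even (4 * k + 3) 8) => //; first by rewrite odd_4mulD.
  + by rewrite -addnS multT.
  + by rewrite coprime_sym.
- by apply: zero_odd; rewrite ?oddM // -[(4 * k).+1]addn1 multT.
- have := iso_even (4 * k + 1) 1; rewrite mul1n multT odd_4mulD -addnS multT addn2; apply=> //.
  exact: coprimen1.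
- rewrite -[(4 * k).+2]addn2; apply: zero_odd; first by rewrite odd_4mulD.
  by rewrite -addnS multT.
Qed.
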